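(* Given $n\ge 2$, $\lambda>0$, $\Lambda>0$, $L\geq 0$ and $m\ge 1$, there exists a constant $C=C(n,\lambda,\Lambda,L,m)$, depending only on these quantities, such that the following holds. Let $\omega\subset\mathbb R^{n-1}$ be a bounded Lipschitz domain and let $\varphi\colon\omega\to\mathbb R$ be a positive Lipschitz function with Lipschitz constant $\mathrm{Lip}(\varphi)=L$, $H=\sup_{x'\in\omega}\varphi(x')$, $h=\inf_{x'\in\omega}\varphi(x')>0$ and $H/h=m$. Let $$\Omega=\{x\in\mathbb R^n : x'\in\omega,\ 0<x_1<\varphi(x')\}.$$ Let $\mathcal L(u)=\sum_{i,j=1}^n a_{ij}\frac{\partial^2u}{\partial x_i\partial x_j}$ be an operator with constant real coefficients such that $\sum_{i,j=1}^n a_{ij}\xi_i\xi_j\ge\lambda|\xi|^2$ for all $\xi\in\mathbb R^n$ and $\sum_{i=1}^n|a_{ij}|\le\Lambda$ for all $1\le j\le n$. Then every $u\in C^3(\bar\Omega)$ that solves $\mathcal L(u)=0$ in $\Omega$ and satisfies $u=0$ on $\Gamma=\{x\in\partial\Omega : x'\in\partial\omega\}$ fulfills $$\|\nabla u\|_{L^2(\Omega)}^2\le\frac{C}{h}\|u\|_{L^2(\Omega)}\|u_{x_1}\|_{L^2(\Omega)}+C\|u_{x_1}\|_{L^2(\Omega)}^2 .$$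
   Context: For $x=(x_1,x_2,\dots,x_n)\in\mathbb R^n$ write $x'=(x_2,\dots,x_n)\in\mathbb R^{n-1}$. Functions are real-valued. *)

(* Defs.v *)
From HB Require Import structures.
From mathcomp Require Import all_boot all_order all_algebra.
From mathcomp Require Import all_classical all_reals all_analysis.

Set Implicit Arguments.
Unset Strict Implicit.
Unset Printing Implicit Defensive.

Import Order.TTheory GRing.Theory Num.Theory.
Import numFieldNormedType.Exports.

Local Open Scope classical_set_scope.
Local Open Scope ring_scope.

Section coordinates.
Context {R : realType}.

Definition xhead n (x : 'rV[R]_n.+1) : R := x ord0 ord0.

Definition xtail n (x : 'rV[R]_n.+1) : 'rV[R]_n :=
  \row_(j < n) x ord0 (lift ord0 j).

Definition xcons n (p : R * 'rV[R]_n) : 'rV[R]_n.+1 :=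
  \row_(i < n.+1) oapp (p.2 ord0) p.1 (unlift ord0 i).

Lemma xheadK n (p : R * 'rV[R]_n) : xhead (xcons p) = p.1.
Proof. by rewrite /xhead mxE unlift_none. Qed.

Lemma xtailK n (p : R * 'rV[R]_n) : xtail (xcons p) = p.2.
Proof. by apply/rowP => j; rewrite !mxE liftK. Qed.

(* The library norm on matrices is the sup norm. *)
Definition enorm n (x : 'rV[R]_n) : R :=
  Num.sqrt (\sum_(i < n) x ord0 i ^+ 2).

End coordinates.

(* 'rV[R]_n carries the product sigma-algebra, as n.-tuple R does in the
   library. *)
Definition measure_rV_display : measure_display. Proof. exact. Qed.

Section measurable_rV.
Context {R : realType} (n : nat).

Let coord (i : 'I_n) (x : 'rV[R]_n) : R := x ord0 i.

Let rV_set0 : g_sigma_preimage coord set0.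
Proof. exact: sigma_algebra0. Qed.

Let rV_setC A : g_sigma_preimage coord A -> g_sigma_preimage coord (~` A).
Proof. exact: sigma_algebraC. Qed.

Let rV_bigcup (F : _^nat) : (forall i, g_sigma_preimage coord (F i)) ->
  g_sigma_preimage coord (\bigcup_i (F i)).
Proof. exact: sigma_algebra_bigcup. Qed.

HB.instance Definition _ := @isMeasurable.Build measure_rV_display
  'rV[R]_n (g_sigma_preimage coord) rV_set0 rV_setC rV_bigcup.

Lemma measurable_coord (i : 'I_n) :
  measurable_fun [set: 'rV[R]_n] (fun x : 'rV[R]_n => x ord0 i).
Proof.
move=> _ Y mY; rewrite setTI; apply: sub_sigma_algebra => /=.
rewrite -bigcup_seq/=; exists i => /=; first by rewrite mem_index_enum.
by exists Y => //; rewrite setTI.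
Qed.

Lemma measurable_fun_rV d (T : measurableType d) (f : T -> 'rV[R]_n) :
  (forall i, measurable_fun [set: T] (fun t => f t ord0 i)) ->
  measurable_fun [set: T] f.
Proof.
move=> mf _ A mA; rewrite setTI.
suff : preimage_set_system [set: T] f (g_sigma_preimage coord) `<=` measurable.
  by apply; exists A => //; rewrite setTI.
rewrite -g_sigma_preimageE; apply: smallest_sub.
  exact: sigma_algebra_measurable.
move=> _ [B + <-]; rewrite -bigcup_seq => -[i _ [C mC <-]].
by have := mf i measurableT _ mC; rewrite !setTI.
Qed.

End measurable_rV.

Section lebesgue_rV.
Context {R : realType}.

Lemma measurable_xcons n : measurable_fun setT (@xcons R n).
Proof.
apply: measurable_fun_rV => i.
case: (unliftP ord0 i) => [j|] ->.
  under eq_fun do rewrite mxE liftK /=.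
  exact: measurableT_comp (measurable_coord j) measurable_snd.
under eq_fun do rewrite mxE unlift_none /=.
exact: measurable_fst.
Qed.

Lemma measurable_fun_headtail n :
  measurable_fun setT (fun x : 'rV[R]_n.+1 => (xhead x, xtail x)).
Proof.
apply: measurable_fun_pair; first exact: measurable_coord.
apply: measurable_fun_rV => i; under eq_fun do rewrite mxE.
exact: measurable_coord.
Qed.

Section step.
Variables (n : nat) (mu : {sigma_finite_measure set 'rV[R]_n -> \bar R}).

Definition lebesgue_rV_step : set 'rV[R]_n.+1 -> \bar R :=
  pushforward (@lebesgue_measure R \x mu)%E (@xcons R n).

Let step : {measure set 'rV[R]_n.+1 -> \bar R} :=
  measure_function_pushforward__canonical__measure_function_Measure
    (@lebesgue_measure R \x mu)%E (@measurable_xcons n).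

Let step0 : lebesgue_rV_step set0 = 0%E.
Proof. exact: (measure0 step). Qed.

Let step_ge0 A : (0 <= lebesgue_rV_step A)%E.
Proof. exact: (measure_ge0 step). Qed.

Let step_sigma_additive : semi_sigma_additive lebesgue_rV_step.
Proof. exact: (@measure_semi_sigma_additive _ _ _ step). Qed.

HB.instance Definition _ := isMeasure.Build _ _ _ lebesgue_rV_step
  step0 step_ge0 step_sigma_additive.

Let step_sigma_finite : sigma_finite setT lebesgue_rV_step.
Proof.
have /sigma_finiteP[F [FT ndF Foo]] := sigma_finiteT (@lebesgue_measure R).
have /sigma_finiteP[G [GT ndG Goo]] := sigma_finiteT mu.
pose ht (x : 'rV[R]_n.+1) := (xhead x, xtail x).
exists (fun k => ht @^-1` (F k `*` G k)).
  apply/esym; rewrite -subTset => x _.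
  have [i _ Fi] : (\bigcup_i F i) (xhead x) by rewrite -FT.
  have [j _ Gj] : (\bigcup_i G i) (xtail x) by rewrite -GT.
  exists (maxn i j) => //; split => /=.
    exact: (subsetPset _ _ (ndF _ _ (leq_maxl i j))).
  exact: (subsetPset _ _ (ndG _ _ (leq_maxr i j))).
move=> k; have [mF Fk] := Foo k; have [mG Gk] := Goo k; split.
  rewrite -[X in measurable X]setTI; apply: measurable_fun_headtail => //.
  exact: measurableX.
rewrite /lebesgue_rV_step /pushforward -comp_preimage.
rewrite (_ : ht \o _ = id) ?preimage_id; last first.
  by apply/funext => -[t y] /=; rewrite /ht xheadK xtailK.
by rewrite product_measure1E// lte_mul_pinfty// ge0_fin_numE.
Qed.

HB.instance Definition _ := Measure_isSigmaFinite.Build _ _ _ lebesgue_rV_step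
  step_sigma_finite.

End step.

(* Lebesgue measure on the Borel sets of R^n: the point mass on R^0, and the
   product of the Lebesgue measures on R and R^n on R^(n+1). *)
Fixpoint lebesgue_rV (n : nat) : {sigma_finite_measure set 'rV[R]_n -> \bar R} :=
  if n is m.+1 then lebesgue_rV_step (lebesgue_rV m) else dirac (0 : 'rV[R]_0).

Lemma lebesgue_rV_box n (A : 'I_n -> set R) : (forall i, measurable (A i)) ->
  lebesgue_rV n [set x : 'rV[R]_n | forall i, A i (x ord0 i)] =
  (\prod_(i < n) @lebesgue_measure R (A i))%E.
Proof.
elim: n A => [|n IHn] A mA /=.
  rewrite big_ord0 diracE mem_set//=; by case.
rewrite /lebesgue_rV_step /pushforward.
have -> : @xcons R n @^-1` [set x | forall i, A i (x ord0 i)] =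
    A ord0 `*` [set x : 'rV[R]_n | forall i : 'I_n, A (lift ord0 i) (x ord0 i)].
  apply/seteqP; split => [[t y] /= h|[t y] /= [h0 h] i].
    split; first by have := h ord0; rewrite mxE unlift_none.
    by move=> i; have := h (lift ord0 i); rewrite mxE liftK.
  by case: (unliftP ord0 i) => [j|] ->; rewrite mxE ?liftK ?unlift_none //=.
set B := [set x : 'rV[R]_n | _].
have mB : measurable B.
  rewrite (_ : B = \bigcap_(i in [set: 'I_n])
      ((fun x : 'rV[R]_n => x ord0 i) @^-1` A (lift ord0 i))).
    apply: fin_bigcap_measurable => // i _.
    by rewrite -[X in measurable X]setTI; apply: measurable_coord.
  by apply/seteqP; split => x /= h i; [move=> _|]; exact: h.
rewrite product_measure1E//; last exact: mA.
rewrite big_ord_recl -IHn// => i; exact: mA.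
Qed.

(* The L^2(Omega) norm, possibly infinite. *)
Definition L2norm n (Omega : set 'rV[R]_n) (f : 'rV[R]_n -> R) : \bar R :=
  ('N[lebesgue_rV n]_2%:E[(EFin \o f) \_ Omega])%E.

End lebesgue_rV.

Section domains.
Context {R : realType}.

Definition bdry n (A : set 'rV[R]_n) : set 'rV[R]_n := closure A `\` A°.

(* The best Lipschitz constant of f on A for the Euclidean distance: +oo if f
   is not Lipschitz on A, -oo if A has at most one point. *)
Definition Lip n (A : set 'rV[R]_n) (f : 'rV[R]_n -> R) : \bar R :=
  ereal_sup [set r | exists x y, [/\ A x, A y, x != y &
    r = (`|f x - f y| / enorm (x - y))%:E]].

(* Near each boundary point, and in suitable orthonormal coordinates, omega is
   the strict epigraph of a Lipschitz function. *)
Definition lipschitz_domain n (omega : set 'rV[R]_n.+1) : Prop :=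
  [/\ omega !=set0, open omega, connected omega &
      forall p, bdry omega p ->
        exists (Q : 'M[R]_n.+1) (g : 'rV[R]_n -> R) (r : R),
          [/\ Q *m Q^T = 1%:M, (Lip [set: 'rV[R]_n] g < +oo)%E, 0 < r &
              forall y, enorm (y - p) < r ->
                (omega y <-> g (xtail (y *m Q)) < xhead (y *m Q))]].

Definition subgraph n (omega : set 'rV[R]_n) (phi : 'rV[R]_n -> R) :
    set 'rV[R]_n.+1 :=
  [set x | omega (xtail x) /\ 0 < xhead x < phi (xtail x)].

Definition lateral_bdry n (omega : set 'rV[R]_n) (Omega : set 'rV[R]_n.+1) :
    set 'rV[R]_n.+1 :=
  bdry Omega `&` [set x | bdry omega (xtail x)].

End domains.

Section derivatives.
Context {R : realType} (n : nat).
Implicit Types (u : 'rV[R]_n -> R) (x : 'rV[R]_n).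

Definition partial (i : 'I_n) u : 'rV[R]_n -> R :=
  fun x => 'D_(delta_mx ord0 i) u x.

Definition partials (s : seq 'I_n) u : 'rV[R]_n -> R := foldr partial u s.

Definition grad u x : 'rV[R]_n := \row_(i < n) partial i u x.

(* u is of class C^k on the closure of the open set Omega: its partial
   derivatives of order at most k exist in Omega and have continuous extensions
   to the closure, the extension of u being u itself. *)
Definition Ck_closure (k : nat) (Omega : set 'rV[R]_n) u : Prop :=
  [/\ forall (s : seq 'I_n) (i : 'I_n) x, (size s < k)%N -> Omega x ->
        derivable (partials s u) x (delta_mx ord0 i),
      {within closure Omega, continuous u} &
      forall s : seq 'I_n, (size s <= k)%N ->
        exists2 g : 'rV[R]_n -> R, {within closure Omega, continuous g} &
          forall x, Omega x -> partials s u x = g x].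

Definition const_op (a : 'M[R]_n) u : 'rV[R]_n -> R :=
  fun x => \sum_(i < n) \sum_(j < n) a i j * partial i (partial j u) x.

End derivatives.

(* Main.v *)
Require Import Defs.
From mathcomp Require Import all_boot all_order all_algebra.
From mathcomp Require Import all_classical all_reals all_analysis.
From mathcomp Require Import measurable_realfun ring lra.

Set Implicit Arguments.
Unset Strict Implicit.
Unset Printing Implicit Defensive.

Import Order.TTheory GRing.Theory Num.Theory.
Import numFieldNormedType.Exports.

Local Open Scope classical_set_scope.
Local Open Scope ring_scope.

(** The proof replaces the divergence theorem by difference quotients: for [W]
    and [F] on a bounded open set [O], translation invariance of the Lebesgue
    measure turns the difference quotient of [F] against [W] into that of [W]
    against [F], up to a layer along the boundary whose measure tends to [0];
    no regularity of the boundary enters, provided [W F] is small near it.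
    With [v := u_1] and [d := min (x_1, phi - x_1)] it is applied three times:
    - with a tent function of [x_1], supported in [[0, h]], as weight and
      [F := u u_j]: the terms with [j != 1] vanish, hence
      [int tent |grad u|^2 <= C int |u u_1|];
    - with weight [d^2] and [F := v v_j]: since [v] solves the same equation,
      [int d^2 |grad v|^2 <= C int v^2];
    - with [F := u_j^2] and a weight of slope [1] in [x_1] near both ends of
      each fibre: a Hardy inequality
      [int u_j^2 <= C / h int tent u_j^2 + C int d^2 v_j^2]. *)

(** Nothing is known about [u] on the bottom and the top of [Omega], so the weights must vanish
    there, and an energy estimate alone loses the gradient near these two faces. The Hardy step
    recovers it along the fibres at the price of the [x_1]-derivative of [u_j], which is [v_j]: this
    is why the energy of [v] is needed and why third derivatives of [u] occur. The boundary terms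
    for [v] are small because [u] vanishes on the vertical segments over the boundary of [omega].
    The two energy weights differ on purpose. A weight for [u] that depends on [x'] would leave
    terms [u u_j] with [j != 1], absent from the right-hand side; the tent depends on [x_1] only and
    lies below the graph since [h <= phi]. For [v] such terms are harmless: [d^2] has slope at most
    [2 (1 + L) d], and [d |v v_j|] is absorbed by AM-GM. The constant comes out as [16 m Lambda /
    lambda + 256 m^2 N (1 + L)^2 Lambda^2 / lambda^2], with [N] the dimension. *)

Section rV_measure.
Context {R : realType}.

(** * Lebesgue measure on R^n: open sets, translations, bounded sets *)

Lemma ball_rV n (x y : 'rV[R]_n) (e : R) : 0 < e ->
  ball x e y <-> forall i, `|x ord0 i - y ord0 i| < e.
Proof.
move=> e0; split=> [[_ h] i|h]; first exact: h.
by split=> // i j; rewrite (ord1 i); exact: h.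
Qed.

Lemma measurable_box n (B : 'I_n -> set R) : (forall i, measurable (B i)) ->
  measurable [set x : 'rV[R]_n | forall i, B i (x ord0 i)].
Proof.
move=> mB; rewrite (_ : mkset _ =
    \bigcap_(i in [set: 'I_n]) ((fun x : 'rV[R]_n => x ord0 i) @^-1` B i)).
  apply: fin_bigcap_measurable => // i _.
  by rewrite -[X in measurable X]setTI; apply: measurable_coord.
by apply/seteqP; split => x /= h i; [move=> _|]; exact: h.
Qed.

(** The sigma-algebra is generated by the coordinates, so open sets have to be reached from boxes:
    an open set is the countable union of the boxes with rational centre and radius [1 / k.+1] that
    it contains. *)
Lemma measurable_open_rV n (A : set 'rV[R]_n) : open A -> measurable A.
Proof.
move=> oA.
pose c (p : 'rV[rat]_n) : 'rV[R]_n := \row_i ratr (p ord0 i).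
pose box (pk : 'rV[rat]_n * nat) : set 'rV[R]_n :=
  [set x | forall i, `|c pk.1 ord0 i - x ord0 i| < pk.2.+1%:R^-1].
pose F (pk : 'rV[rat]_n * nat) := [set x | box pk `<=` A /\ box pk x].
have -> : A = \bigcup_pk F pk.
  apply/seteqP; split => [x Ax|x [pk _ [hA hx]]]; last exact: hA.
  have /nbhs_ballP[e /= e0 eA] : nbhs x A by exact: open_nbhs_nbhs.
  have e20 : 0 < e / 2 by rewrite divr_gt0.
  have [k _ /(_ k (leqnn k)) /= ke] := near_infty_natSinv_lt (PosNum e20).
  have k0 : 0 < k.+1%:R^-1 :> R by rewrite invr_gt0.
  have /(_ _)/cid2-/all_sig2[q _ qx] (i : 'I_n) : exists2 q : rat, True &
      `|ratr q - x ord0 i| < k.+1%:R^-1.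
    have [|q] := @rat_in_itvoo R (x ord0 i - k.+1%:R^-1) (x ord0 i).
      by rewrite ltrBlDr ltrDl.
    rewrite in_itv/= => /andP[q1 q2]; exists q => //.
    by rewrite ltr_norml ltrBrDr addrC q1 ltrBlDr (lt_trans q2)// ltrDr.
  exists (\row_i q i, k) => //; split => [y|i]; last by rewrite !mxE qx.
  move=> yq; apply: eA; apply/ball_rV => // i.
  have := yq i; have := qx i; rewrite /= !mxE => q1 q2.
  have -> : x ord0 i - y ord0 i = (ratr (q i) - y ord0 i) -
    (ratr (q i) - x ord0 i) by ring.
  by rewrite (le_lt_trans (ler_normB _ _))// (lt_trans (ltrD q2 q1))// [ltRHS]splitr ltrD.
apply: countable_bigcupT_measurable => // pk.
have [h|h] := pselect (box pk `<=` A).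
  rewrite (_ : F pk = box pk).
    exact: (@measurable_box n (fun i => ball (c pk.1 ord0 i) pk.2.+1%:R^-1)
      (fun i => measurable_ball _ _)).
  by apply/seteqP; split => [x []|x ?].
by rewrite (_ : F pk = set0)//; apply/seteqP; split => [x []|].
Qed.

Lemma measurable_fun_open_rV n (A : set 'rV[R]_n) (f : 'rV[R]_n -> R) :
  open A -> (forall x, A x -> {for x, continuous f}) -> measurable_fun A f.
Proof.
move=> oA cf; apply: (measurability _ (RGenOpens.measurableE R)).
move=> _ [_ [a [b ->] <-]]; apply: measurable_open_rV.
rewrite openE => x [Ax fx]; have nA : nbhs x A by exact: open_nbhs_nbhs.
apply: filterI => //; apply: cf => //.
by apply: open_nbhs_nbhs; split => //; exact: interval_open.
Qed.

Lemma lebesgue_measure_shift (a : R) (A : set R) : measurable A ->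
  lebesgue_measure ((fun x => x + a) @^-1` A) = lebesgue_measure A.
Proof.
move=> mA; apply/esym.
have mf : measurable_fun setT (fun x : measurableTypeR R => x + a : measurableTypeR R).
  exact: measurable_funD.
pose mu : {measure set (measurableTypeR R) -> \bar R} :=
  measure_function_pushforward__canonical__measure_function_Measure
    (@lebesgue_measure R) mf.
apply: (@lebesgue_measure_unique R mu) => // X /ocitvP[->|[[b c] /= bc ->]].
  by rewrite !measure0.
rewrite /mu /= /pushforward.
rewrite (_ : _ @^-1` _ = `]b - a, c - a]%classic); last first.
  by apply/seteqP; split => x; rewrite /= !in_itv/= => /andP[? ?];
    apply/andP; split; lra.
by rewrite !lebesgue_measure_itv/= !lte_fin ltrD2r -!EFinB; case: ifP => // _;
  congr EFin; ring.
Qed.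

(** Induction on the dimension: the image of the product measure under a translation agrees with it
    on rectangles, hence everywhere by uniqueness of product measures. Every integration by parts
    below rests on this invariance. *)
Lemma lebesgue_rV_shift n (v : 'rV[R]_n) (A : set 'rV[R]_n) : measurable A ->
  lebesgue_rV n ((fun x => x + v) @^-1` A) = lebesgue_rV n A.
Proof.
elim: n v A => [|n IHn] v A mA.
  by congr (lebesgue_rV 0 _); apply/seteqP; split => x /=;
    rewrite [x + v]thinmx0 (_ : x = 0) // [x]thinmx0.
rewrite /= /lebesgue_rV_step /pushforward.
pose T (p : measurableTypeR R * 'rV[R]_n) : measurableTypeR R * 'rV[R]_n :=
  (p.1 + xhead v, p.2 + xtail v).
have mT : measurable_fun setT T.
  apply: measurable_fun_pair; first exact: measurable_funD.
  apply: measurable_fun_rV => i.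
  under eq_fun do rewrite mxE.
  apply: measurable_funD => //.
  exact: measurableT_comp (measurable_coord i) measurable_snd.
have mB : measurable (@xcons R n @^-1` A).
  by rewrite -[X in measurable X]setTI; exact: measurable_xcons.
pose mu : {measure set _ -> \bar R} :=
  measure_function_pushforward__canonical__measure_function_Measure
    (@lebesgue_measure R \x lebesgue_rV n)%E mT.
transitivity (mu (@xcons R n @^-1` A)); last first.
  apply/esym/product_measure_unique => // B C mB' mC.
  rewrite /mu /= /pushforward.
  rewrite (_ : T @^-1` _ = ((fun x => x + xhead v) @^-1` B) `*`
    ((fun x => x + xtail v) @^-1` C))//.
  rewrite product_measure1E.
  - by congr (_ * _)%E; [exact: lebesgue_measure_shift|exact: IHn].
  - rewrite -[X in measurable X]setTI.
    have : measurable_fun setT (fun x : R => x + xhead v) by exact: measurable_funD.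
    exact.
  - rewrite -[X in measurable X]setTI.
    have : measurable_fun setT (fun x : 'rV[R]_n => x + xtail v).
      apply: measurable_fun_rV => i; under eq_fun do rewrite mxE.
      by apply: measurable_funD => //; exact: measurable_coord.
    exact.
rewrite /mu /= /pushforward; congr (product_measure1 _ _ _).
apply/seteqP; split => p /=; rewrite (_ : xcons p + v = xcons (T p)) //;
  apply/rowP => i; rewrite !mxE; case: (unliftP ord0 i) => [j|] ->;
    by rewrite ?liftK ?unlift_none /= ?mxE.
Qed.

Lemma lebesgue_rV_bounded n (A : set 'rV[R]_n) : measurable A ->
  bounded_set A -> (lebesgue_rV n A < +oo)%E.
Proof.
move=> mA [M [_ /(_ (M + 1))]].
rewrite ltrDl ltr01 => /(_ isT) AM.
pose B (i : 'I_n) : set R := `[- (M + 1), M + 1]%classic.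
apply: (@le_lt_trans _ _ (lebesgue_rV n [set x | forall i, B i (x ord0 i)])).
  apply: le_measure => [||x /AM xM i]; rewrite ?inE//.
    by apply: measurable_box => i; exact: measurable_itv.
  rewrite /B /= in_itv/= -ler_norml.
  apply: le_trans xM; rewrite [leRHS]/Num.Def.normr /= mx_normrE.
  exact: (@le_bigmax _ _ _ 0 (fun ij : 'I_1 * 'I_n => `|x ij.1 ij.2|) (ord0, i)).
rewrite lebesgue_rV_box//; last by move=> i; exact: measurable_itv.
suff : (\prod_(i < n) lebesgue_measure (B i))%E \is a fin_num.
  by rewrite fin_numE => /andP[_]; rewrite -ltey.
elim/big_ind : _ => [//|x y xf yf|i _]; first by rewrite fin_numM.
by rewrite lebesgue_measure_itv/=; case: ifP.
Qed.

End rV_measure.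

(** * Calculus of bounded measurable functions on a set of finite measure *)

Section bounded_measurable.
Context d (T : measurableType d) (R : realType).
Variables (mu : {measure set T -> \bar R}) (D : set T).
Hypotheses (mD : measurable D) (muD : (mu D < +oo)%E).
Implicit Types f g : T -> R.

(** On a set of finite measure these functions form an algebra of integrable functions, so the rules
    for integrals below carry no separate integrability conditions. *)
Definition bounded_measurable f :=
  measurable_fun D f /\ exists M : R, forall x, D x -> `|f x| <= M.

Local Notation bm := bounded_measurable.

Lemma bounded_measurable_cst r : bm (fun=> r).
Proof. by split; [exact: measurable_cst|exists `|r|]. Qed.

Lemma bounded_measurableD f g : bm f -> bm g -> bm (fun x => f x + g x).
Proof.
move=> [mf [M fM]] [mg [N gN]]; split; first exact: measurable_funD.
exists (M + N) => x Dx; rewrite (le_trans (ler_normD _ _))// lerD//; auto.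
Qed.

Lemma bounded_measurableM f g : bm f -> bm g -> bm (fun x => f x * g x).
Proof.
move=> [mf [M fM]] [mg [N gN]]; split; first exact: measurable_funM.
by exists (M * N) => x Dx; rewrite normrM ler_pM//; auto.
Qed.

Lemma bounded_measurableZ r f : bm f -> bm (fun x => r * f x).
Proof. by move=> bf; apply: bounded_measurableM => //; exact: bounded_measurable_cst. Qed.

Lemma bounded_measurableN f : bm f -> bm (fun x => - f x).
Proof.
move=> bf; rewrite (_ : (fun _ => _) = (fun x => -1 * f x)).
  exact: bounded_measurableZ.
by apply/funext => x; rewrite mulN1r.
Qed.

Lemma bounded_measurableB f g : bm f -> bm g -> bm (fun x => f x - g x).
Proof.
by move=> bf bg; apply: bounded_measurableD => //; exact: bounded_measurableN.
Qed.

Lemma bounded_measurable_norm f : bm f -> bm (fun x => `|f x|).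
Proof.
move=> [mf [M fM]]; split; first exact: measurableT_comp.
by exists M => x Dx; rewrite normr_id; exact: fM.
Qed.

Lemma bounded_measurableX n f : bm f -> bm (fun x => f x ^+ n).
Proof.
move=> [mf [M fM]]; split; first exact: measurable_funX.
exists (M ^+ n) => x Dx; rewrite normrX lerXn2r ?fM ?nnegrE//.
exact: le_trans (normr_ge0 _) (fM _ Dx).
Qed.

Lemma bounded_measurable_sum (I : Type) (r : seq I) (F : I -> T -> R) :
  (forall i, bm (F i)) -> bm (fun x => \sum_(i <- r) F i x).
Proof.
move=> bF; elim: r => [|i r IHr].
  rewrite (_ : (fun _ => _) = (fun=> 0)); first exact: bounded_measurable_cst.
  by apply/funext => x; rewrite big_nil.
rewrite (_ : (fun _ => _) = (fun x => F i x + \sum_(j <- r) F j x)).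
  exact: bounded_measurableD.
by apply/funext => x; rewrite big_cons.
Qed.

Lemma eq_bounded_measurable f g : (forall x, D x -> f x = g x) -> bm f -> bm g.
Proof.
move=> fg [mf [M fM]]; split; last by exists M => x Dx; rewrite -fg//; auto.
by apply: eq_measurable_fun mf => x /set_mem; exact: fg.
Qed.

Lemma bounded_measurable_bound f : bm f ->
  exists2 M : R, 0 <= M & forall x, D x -> `|f x| <= M.
Proof.
move=> [_ [M fM]]; exists `|M| => // x /fM fx.
exact: le_trans fx (ler_norm _).
Qed.

Lemma bounded_measurable_integrable f : bm f -> mu.-integrable D (EFin \o f).
Proof.
move=> [mf [M fM]]; apply: measurable_bounded_integrable => //.
exists M; split; first exact: num_real.
by move=> N MN x Dx; exact: le_trans (fM _ Dx) (ltW MN).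
Qed.

Local Hint Resolve bounded_measurable_integrable : core.

Lemma bounded_le_Rintegral f g : bm f -> bm g -> (forall x, D x -> f x <= g x) ->
  \int[mu]_(x in D) f x <= \int[mu]_(x in D) g x.
Proof. by move=> bf bg; apply: le_Rintegral; auto. Qed.

Lemma bounded_RintegralD f g : bm f -> bm g ->
  \int[mu]_(x in D) (f x + g x) =
  \int[mu]_(x in D) f x + \int[mu]_(x in D) g x.
Proof. by move=> bf bg; rewrite RintegralD//; auto. Qed.

Lemma bounded_RintegralB f g : bm f -> bm g ->
  \int[mu]_(x in D) (f x - g x) =
  \int[mu]_(x in D) f x - \int[mu]_(x in D) g x.
Proof. by move=> bf bg; rewrite RintegralB//; auto. Qed.

Lemma bounded_RintegralZ r f : bm f ->
  \int[mu]_(x in D) (r * f x) = r * \int[mu]_(x in D) f x.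
Proof. by move=> bf; rewrite RintegralZl//; auto. Qed.

Lemma bounded_Rintegral_sum (I : Type) (r : seq I) (F : I -> T -> R) :
  (forall i, bm (F i)) ->
  \int[mu]_(x in D) (\sum_(i <- r) F i x) =
  \sum_(i <- r) \int[mu]_(x in D) F i x.
Proof.
move=> bF; elim: r => [|i r IHr].
  under eq_Rintegral do rewrite big_nil.
  by rewrite big_nil Rintegral_cst// mul0r.
under eq_Rintegral do rewrite big_cons.
by rewrite big_cons bounded_RintegralD ?IHr//; exact: bounded_measurable_sum.
Qed.

Lemma bounded_Rintegral_cvg (f_ : nat -> T -> R) f M :
  (forall k, measurable_fun D (f_ k)) -> measurable_fun D f ->
  (forall k x, D x -> `|f_ k x| <= M) ->
  (forall x, D x -> f_ ^~ x @ \oo --> f x) ->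
  (fun k => \int[mu]_(x in D) f_ k x) @ \oo --> \int[mu]_(x in D) f x.
Proof.
move=> mf_ mf fM cf.
have iM : mu.-integrable D (EFin \o (fun=> M)).
  exact/bounded_measurable_integrable/bounded_measurable_cst.
have [intf _ cvgf] : [/\ mu.-integrable D (EFin \o f),
  [sequence \int[mu]_(x in D) `|(f_ n x)%:E - (f x)%:E|]_n @ \oo --> 0 &
  [sequence \int[mu]_(x in D) (f_ n x)%:E]_n @ \oo --> \int[mu]_(x in D) (f x)%:E]%E.
  apply: (@dominated_convergence _ _ _ mu D mD (fun n x => (f_ n x)%:E)
    (EFin \o f) (EFin \o (fun=> M))) => //.
  - by move=> n; exact/measurable_EFinP.
  - exact/measurable_EFinP.
  - by apply: aeW => x Dx; apply: cvg_EFin; [exact: nearW|exact: cf].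
  - by apply: aeW => x n Dx; rewrite /= lee_fin; exact: fM.
have fin : (\int[mu]_(x in D) (f x)%:E)%E \is a fin_num.
  exact: integrable_fin_num.
by rewrite -(fineK fin) in cvgf; exact: fine_cvg cvgf.
Qed.

End bounded_measurable.

(** * Derivatives along a line, symmetry of second derivatives, exit times *)

Section lines.
Context {R : realType} {V : normedModType R}.
Implicit Types (f : V -> R) (x v w : V).

Lemma is_derive_line f x v (t : R) : derivable f (x + t *: v) v ->
  is_derive t 1 (fun s : R => f (x + s *: v)) ('D_v f (x + t *: v)).
Proof.
move=> df.
have E : (fun h : R => h^-1 *: (f (x + (h *: (1 : R) + t) *: v) - f (x + t *: v))) =
   (fun h : R => h^-1 *: (f (h *: v + (x + t *: v)) - f (x + t *: v))).
  apply/funext => h; congr (_ *: (f _ - _)).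
  by rewrite scalerDl addrCA [h *: 1]mulr1.
apply: DeriveDef; first by rewrite /derivable /= E; exact: df.
by rewrite /derive /= E.
Qed.

Lemma MVT_line f x v (t : R) :
  (forall c : R, 0 <= c <= 1 -> derivable f (x + (c * t) *: v) v) ->
  exists2 c : R, 0 <= c <= 1 &
    f (x + t *: v) - f x = t * 'D_v f (x + (c * t) *: v).
Proof.
move=> df.
pose G (s : R) := f (x + s *: v).
have dg (c : R) : 0 <= c <= 1 ->
    is_derive c 1 (G \o *%R^~ t) (t * 'D_v f (x + (c * t) *: v)).
  move=> /df /is_derive_line dG.
  have dt : is_derive c 1 ( *%R^~ t : R -> R) t.
    rewrite (_ : *%R^~ t = t *: id); last by apply/funext => s; rewrite /= mulrC.
    by apply: is_derive_eq; rewrite [_ *: _]mulr1.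
  by apply: is_derive_eq; rewrite [_ * t]mulrC.
have [c c01||c c01 fE] := @MVT_segment R (G \o *%R^~ t)
  (fun c => t * 'D_v f (x + (c * t) *: v)) 0 1 ler01.
- by apply: dg; move: c01; rewrite in_itv/= => /andP[? ?]; rewrite !ltW.
- apply: derivable_within_continuous => c; rewrite in_itv/= => c01.
  exact: (@ex_derive _ _ _ _ _ _ _ (dg _ c01)).
exists c; first by move: c01; rewrite in_itv.
by move: fE; rewrite /= /G mul0r scale0r addr0 mul1r subr0 mulr1.
Qed.

Lemma lipschitz_line f x v (t B : R) :
  (forall c : R, 0 <= c <= 1 -> derivable f (x + (c * t) *: v) v) ->
  (forall c : R, 0 <= c <= 1 -> `|'D_v f (x + (c * t) *: v)| <= B) ->
  `|f (x + t *: v) - f x| <= B * `|t|.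
Proof.
move=> /MVT_line[c c01 ->] fB; rewrite normrM mulrC.
by rewrite ler_wpM2r// fB.
Qed.

Lemma is_derive_shift f x v w : derivable f (x + w) v ->
  is_derive x v (fun z => f (z + w)) ('D_v f (x + w)).
Proof.
move=> df.
have E : (fun h : R => h^-1 *: (f (h *: v + x + w) - f (x + w))) =
   (fun h : R => h^-1 *: (f (h *: v + (x + w)) - f (x + w))).
  by apply/funext => h; rewrite addrA.
apply: DeriveDef; first by rewrite /derivable /= E; exact: df.
by rewrite /derive /= E.
Qed.

(** The mean value theorem twice: in direction [v] for [f (z + t w) - f z], then in direction [w]
    for [fv]. *)
Lemma second_difference f fv fvw x v w (t : R) :
  (forall a b : R, 0 <= a <= 1 -> 0 <= b <= 1 ->
    let y := x + (a * t) *: v + (b * t) *: w in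
    is_derive y v f (fv y) /\ is_derive y w fv (fvw y)) ->
  exists a b : R, [/\ 0 <= a <= 1, 0 <= b <= 1 &
    f (x + t *: v + t *: w) - f (x + t *: v) - (f (x + t *: w) - f x) =
    t * (t * fvw (x + (a * t) *: v + (b * t) *: w))].
Proof.
move=> df.
have i0 : 0 <= (0 : R) <= 1 by rewrite lexx ler01.
have i1 : 0 <= (1 : R) <= 1 by rewrite lexx ler01.
pose g z := f (z + t *: w) - f z.
have dg (a : R) : 0 <= a <= 1 -> is_derive (x + (a * t) *: v) v g
    (fv (x + (a * t) *: v + t *: w) - fv (x + (a * t) *: v)).
  move=> a01; have [dw _] := df a 1 a01 i1; have [d0 _] := df a 0 a01 i0.
  rewrite /= mul1r in dw; rewrite /= mul0r scale0r addr0 in d0.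
  have := is_derive_shift (@ex_derive _ _ _ _ _ _ _ dw).
  by rewrite (@derive_val _ _ _ _ _ _ _ dw) => d1; exact: is_deriveB.
have [|a a01] := @MVT_line g x v t.
  by move=> a a01; exact: (@ex_derive _ _ _ _ _ _ _ (dg _ a01)).
rewrite (@derive_val _ _ _ _ _ _ _ (dg _ a01)).
have [|b b01 ->] := @MVT_line fv (x + (a * t) *: v) w t.
  by move=> b b01; have [_ d] := df a b a01 b01; exact: ex_derive.
have [_ d] := df a b a01 b01; rewrite (@derive_val _ _ _ _ _ _ _ d) => gE.
by exists a, b; split => //; rewrite -gE.
Qed.

(** Schwarz's theorem: the second difference is symmetric in [v] and [w], hence equals [t^2] times
    either mixed derivative at some point of a small parallelogram at [x], and both are continuous
    at [x]. *)
Lemma is_derive_comm (O : set V) f fv fw fvw fwv x v w : open O -> O x ->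
  (forall y, O y -> is_derive y v f (fv y) /\ is_derive y w f (fw y)) ->
  (forall y, O y -> is_derive y w fv (fvw y) /\ is_derive y v fw (fwv y)) ->
  {for x, continuous fvw} -> {for x, continuous fwv} -> fvw x = fwv x.
Proof.
move=> oO Ox d1 d2 c1 c2; apply/eqP; rewrite -subr_eq0 -normr_le0.
apply/ler_addgt0Pl => e e0; rewrite addr0.
have e2 : 0 < e / 2 by rewrite divr_gt0.
have n0 : nbhs x O by exact: open_nbhs_nbhs.
have /cvgrPdist_lt/(_ _ e2) n1 := c1.
have /cvgrPdist_lt/(_ _ e2) n2 := c2.
have : \forall y \near x, [/\ O y, `|fvw x - fvw y| < e / 2 &
    `|fwv x - fwv y| < e / 2].
  exact: filterS3 (fun y a b c => And3 a b c) n0 n1 n2.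
move=> /nbhs_ballP[r /= r0 rP].
have [t t0 tr] : exists2 t : R, 0 < t & t * (`|v| + `|w|) < r.
  exists (r / (`|v| + `|w| + 1)).
    by rewrite divr_gt0// ltr_wpDl// addr_ge0.
  by rewrite mulrAC ltr_pdivrMr ?ltr_wpDl ?addr_ge0// ltr_pM2l// ltrDl.
have near (a b : R) : 0 <= a <= 1 -> 0 <= b <= 1 ->
    ball x r (x + (a * t) *: v + (b * t) *: w).
  move=> /andP[a0 a1] /andP[b0 b1]; rewrite -ball_normE /ball_ /= -addrA opprD addNKr.
  rewrite normrN (le_lt_trans _ tr)// (le_trans (ler_normD _ _))//.
  rewrite !normrZ (ger0_norm a0) (ger0_norm b0) (gtr0_norm t0) mulrDr.
  by rewrite lerD// -mulrA ler_piMl// mulr_ge0// ltW.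
have [a [b [a01 b01]]] : exists a b : R, [/\ 0 <= a <= 1, 0 <= b <= 1 &
    f (x + t *: v + t *: w) - f (x + t *: v) - (f (x + t *: w) - f x) =
    t * (t * fvw (x + (a * t) *: v + (b * t) *: w))].
  apply: second_difference => a b a01 b01.
  have [Oy _ _] := rP _ (near _ _ a01 b01).
  exact: (conj (d1 _ Oy).1 (d2 _ Oy).1).
have [a' [b' [a01' b01']]] : exists a b : R, [/\ 0 <= a <= 1, 0 <= b <= 1 &
    f (x + t *: w + t *: v) - f (x + t *: w) - (f (x + t *: v) - f x) =
    t * (t * fwv (x + (a * t) *: w + (b * t) *: v))].
  apply: second_difference => a' b' a01' b01'; rewrite addrAC.
  have [Oy _ _] := rP _ (near _ _ b01' a01').
  exact: (conj (d1 _ Oy).2 (d2 _ Oy).2).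
rewrite (addrAC x) (addrAC _ ((a' * t) *: w)) => E1 E2.
have {E1 E2} : t * (t * fvw (x + (a * t) *: v + (b * t) *: w)) =
    t * (t * fwv (x + (b' * t) *: v + (a' * t) *: w)).
  rewrite -E1 -E2; ring.
move=> /(mulfI (lt0r_neq0 t0)) /(mulfI (lt0r_neq0 t0)) E.
have [_ + _] := rP _ (near _ _ a01 b01); rewrite E.
have [_ _ +] := rP _ (near _ _ b01' a01').
move: (fwv (_ + _)) (fvw x) (fwv x) => A B C AC BC.
rewrite (_ : B - C = (B - A) - (C - A)); last by ring.
by rewrite (le_trans (ler_normB _ _))// [leRHS]splitr lerD// ltW.
Qed.

(** [c] is the infimum of the times spent outside [O]; openness makes it positive and makes the
    point at time [c] itself lie outside. *)
Lemma exit_time (O : set V) x v (t : R) : open O -> O x -> ~ O (x + t *: v) ->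
  exists c : R, [/\ 0 < c <= 1, ~ O (x + (c * t) *: v) &
    forall b, 0 <= b < c -> O (x + (b * t) *: v)].
Proof.
move=> oO Ox nO.
pose S := [set b : R | 0 <= b /\ ~ O (x + (b * t) *: v)].
have S1 : S 1 by split => //; rewrite mul1r.
have lbS : has_lbound S by exists 0 => b [].
have infS : has_inf S by split => //; exists 1.
have cv : continuous (fun b : R => x + (b * t) *: v).
  move=> b; apply: cvgD; first exact: cvg_cst.
  by apply: cvgZr_tmp; apply: cvgMl; exact: cvg_id.
have nOc : ~ O (x + (inf S * t) *: v).
  move=> Oc; have : nbhs (x + (inf S * t) *: v) O by exact: open_nbhs_nbhs.
  move=> /(cv (inf S)) /nbhs_ballP[e /= e0 eO].
  have [b Sb be] := inf_adherent e0 infS.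
  have := Sb.2; apply; apply: eO => /=.
  by rewrite /ball /= ltr_norml ltrBlDr ltrBrDr;
    have := ge_inf lbS Sb; lra.
have c0 : 0 <= inf S by apply: lb_le_inf; [exists 1|move=> b []].
exists (inf S); split => //.
  rewrite (ge_inf lbS S1) andbT lt_neqAle c0 andbT; apply/eqP => c0'.
  by apply: nOc; rewrite -c0' mul0r scale0r addr0.
move=> b /andP[b0 bc]; apply: contrapT => nOb.
by have := ge_inf lbS (conj b0 nOb : S b); rewrite leNgt bc.
Qed.

End lines.

(** * Integration by parts through difference quotients *)

Section integration_by_parts.
Context {R : realType} (n : nat).
Local Notation mu := (@lebesgue_rV R n).
Local Notation bm := (bounded_measurable (R:=R)).

Lemma measurable_shift (w : 'rV[R]_n) :
  measurable_fun setT (fun y : 'rV[R]_n => y + w).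
Proof.
apply: measurable_fun_rV => i; under eq_fun do rewrite mxE.
by apply: measurable_funD => //; exact: measurable_coord.
Qed.

Lemma Rintegral_shift (w : 'rV[R]_n) (g : 'rV[R]_n -> R) :
  measurable_fun setT g ->
  mu.-integrable setT (EFin \o (fun y => g (y + w))) ->
  \int[mu]_(y in setT) g (y + w) = \int[mu]_(y in setT) g y.
Proof.
move=> mg ig; congr fine.
transitivity (\int[pushforward mu (fun y : 'rV[R]_n => (y + w)%R)]_(y in setT) (g y)%:E)%E.
  rewrite (integral_pushforward (measurable_shift w))//.
  exact/measurable_EFinP.
apply: eq_measure_integral; first exact: measurable_shift.
by move=> mw A mA _; exact: lebesgue_rV_shift.
Qed.

Variables (O : set 'rV[R]_n) (v : 'rV[R]_n).
Hypotheses (oO : open O) (finO : (mu O < +oo)%E).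
Let mO : measurable O := measurable_open_rV oO.

Lemma bounded_measurable_restrict (f : 'rV[R]_n -> R) : bm O f ->
  bm setT (f \_ O).
Proof.
move=> [mf [M fM]]; split; first exact: (measurable_restrictT f mO).1 mf.
exists `|M| => x _; rewrite patchE; case: ifPn => [/set_mem /fM fx|_].
  exact: le_trans fx (ler_norm _).
by rewrite normr0.
Qed.

Lemma bounded_measurable_shift (w : 'rV[R]_n) (f : 'rV[R]_n -> R) :
  bm setT f -> bm O (fun y => f (y + w)).
Proof.
move=> [mf [M fM]]; split; last by exists M => x _; exact: fM.
apply: measurable_funTS; exact: measurableT_comp mf (measurable_shift w).
Qed.

(** Both functions are extended by [0], so a translation of the whole space moves the shift from [F]
    to [W] and no boundary term appears. *)
Lemma Rintegral_restrict_shift (F W : 'rV[R]_n -> R) (w : 'rV[R]_n) :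
  bm O F -> bm O W ->
  \int[mu]_(y in O) ((F \_ O) (y + w) * W y) =
  \int[mu]_(y in O) (F y * (W \_ O) (y - w)).
Proof.
move=> bF bW; rewrite Rintegral_mkcond [RHS]Rintegral_mkcond.
have bF0 := bounded_measurable_restrict bF.
have bW0 := bounded_measurable_restrict bW.
have -> : (fun y => (F \_ O) (y + w) * W y) \_ O =
    (fun y => (F \_ O) (y + w) * (W \_ O) (y + w - w)).
  by apply/funext => y; rewrite addrK !patchE; case: ifP; rewrite ?mulr0.
have -> : (fun y => F y * (W \_ O) (y - w)) \_ O =
    (fun y => (F \_ O) y * (W \_ O) (y - w)).
  by apply/funext => y; rewrite !patchE; case: (y \in O); rewrite ?mul0r.
apply: (@Rintegral_shift w (fun y => (F \_ O) y * (W \_ O) (y - w))).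
  apply: measurable_funM; first exact: bF0.1.
  exact: measurableT_comp bW0.1 (measurable_shift (- w)).
rewrite (_ : EFin \o _ = (EFin \o (fun y => (F \_ O) (y + w) * W y)) \_ O).
  apply: (integrable_mkcond _ mO).1; apply: bounded_measurable_integrable => //.
  by apply: bounded_measurableM => //; exact: bounded_measurable_shift.
apply/funext => y; rewrite /= addrK [in RHS]patchE [X in _ * X]patchE.
(* Off [O] the restriction takes the default value [point], which is [0] in [R]. *)
case: ifP => //= _; by rewrite (_ : point = 0)// mulr0.
Qed.

Lemma difference_quotient_cvg (F : 'rV[R]_n -> R) (l : R) (y : 'rV[R]_n) :
  is_derive y v F l ->
  (fun k => k.+1%:R * (F (y + k.+1%:R^-1 *: v) - F y)) @ \oo --> l.
Proof.
move=> [dF <-].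
have h0 : (fun k => k.+1%:R^-1 : R) @ \oo --> (0 : R)^'.
  move=> A /= nA.
  have : \forall k \near \oo, (k.+1%:R^-1 != 0 :> R -> A k.+1%:R^-1).
    exact: (@cvg_harmonic R _ nA).
  by apply: filterS => k; apply; rewrite invr_neq0// pnatr_eq0.
have := cvg_comp _ _ h0 dF; apply: cvg_trans; apply: near_eq_cvg.
by apply: nearW => k; rewrite /= invrK [_ *: _ + _]addrC.
Qed.

Lemma shift_in_open (y : 'rV[R]_n) (w : 'rV[R]_n) : O y ->
  \forall k \near \oo, O (y + k.+1%:R^-1 *: w).
Proof.
move=> Oy; have : nbhs y O by exact: open_nbhs_nbhs.
suff : (fun k => y + (k.+1%:R^-1 : R) *: w) @ \oo --> y + 0 *: w.
  by rewrite scale0r addr0 => /[apply].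
by apply: cvgD; [exact: cvg_cst|apply: cvgZr_tmp; exact: cvg_harmonic].
Qed.

Variables (F dF W kappa : 'rV[R]_n -> R) (B K M : R).
Hypotheses (bF : bm O F) (bdF : bm O dF) (bW : bm O W) (bk : bm O kappa).
Hypotheses (B0 : 0 <= B) (K0 : 0 <= K).
Hypothesis FdF : forall y, O y -> is_derive y v F (dF y).
Hypothesis lipW : forall y (t : R), O y -> O (y + t *: v) ->
  `|W (y + t *: v) - W y| <= K * `|t|.
Hypothesis exitWF : forall y (t : R), O y -> ~ O (y + t *: v) ->
  `|W y * F y| <= B * `|t|.
Hypothesis WF_le : forall y (s : R), 0 < s -> O y -> O (y - s *: v) ->
  (W (y - s *: v) - W y) * F y <= s * (kappa y + s * M).

(** The domination needed to pass to the limit. The segment from [y] to [y + s v] may end outside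
    [O], stay in [O], or leave [O] and come back; only the second case is a mean value inequality
    for [F]. *)
Lemma difference_quotient_bounded : exists C, forall (s : R) y, 0 < s -> O y ->
  `|W y * ((F \_ O) (y + s *: v) - F y)| <= s * C.
Proof.
have [CF CF0 FC] := bounded_measurable_bound bF.
have [CD CD0 DC] := bounded_measurable_bound bdF.
have [CW CW0 WC] := bounded_measurable_bound bW.
have P1 : 0 <= CW * CD by rewrite mulr_ge0.
have P2 : 0 <= K * CF by rewrite mulr_ge0.
exists (CW * CD + (2 * B + K * CF)) => s y s0 Oy.
rewrite patchE; case: ifPn => [/set_mem Oys|/negP nOys]; last first.
  have {}nOys : ~ O (y + s *: v) by move=> h; apply: nOys; exact: mem_set.
  rewrite sub0r mulrN normrN (le_trans (exitWF Oy nOys))// gtr0_norm// mulrC.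
  rewrite ler_wpM2l ?(ltW s0)//.
  have H (a b c : R) : 0 <= a -> 0 <= b -> 0 <= c ->
    c <= a + (2 * c + b) by lra.
  exact: H.
have [seg|] := pselect (forall c : R, 0 <= c <= 1 -> O (y + (c * s) *: v)).
  have h : `|F (y + s *: v) - F y| <= CD * `|s|.
    apply: lipschitz_line => c c01; have Oc := seg _ c01.
      exact: (@ex_derive _ _ _ _ _ _ _ (FdF Oc)).
    by rewrite (@derive_val _ _ _ _ _ _ _ (FdF Oc)) DC.
  rewrite normrM; apply: (@le_trans _ _ (CW * (CD * `|s|))).
    by apply: ler_pM => //; exact: WC.
  rewrite gtr0_norm// mulrDr mulrA [leLHS]mulrC lerDl mulr_ge0 ?(ltW s0)//.
  by rewrite addr_ge0// mulr_ge0.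
(* The segment leaves [O] and returns. [F] is not controlled along it, but [W F] is [O(s)] at both
   ends, each seen from the same outer point (with a negative time from the far end), and [lipW]
   compares the two values of [W]. *)
move=> /existsNP[c /not_implyP[/andP[c0 c1] nOc]].
have h1 : `|W y * F y| <= B * s.
  rewrite (le_trans (exitWF Oy nOc))// ler_wpM2l// normrM !ger0_norm ?(ltW s0)//.
  by rewrite ler_piMl// ltW.
have h2 : `|W (y + s *: v) * F (y + s *: v)| <= B * s.
  have e : y + (c * s) *: v = y + s *: v + ((c - 1) * s) *: v.
    by rewrite mulrBl mul1r scalerBl addrACA subrr addr0 addrC.
  rewrite e in nOc; rewrite (le_trans (exitWF Oys nOc))// ler_wpM2l//.
  rewrite normrM ler0_norm ?subr_le0// gtr0_norm// opprB.
  by rewrite ler_piMl ?(ltW s0)// lerBlDr lerDl.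
have h3 := lipW Oy Oys; rewrite (gtr0_norm s0) in h3.
have h4 : `|(W (y + s *: v) - W y) * F (y + s *: v)| <= K * s * CF.
  by rewrite normrM ler_pM// FC.
rewrite mulrBr (_ : W y * _ - _ = W (y + s *: v) * F (y + s *: v) -
  (W (y + s *: v) - W y) * F (y + s *: v) - W y * F y); last by ring.
rewrite (le_trans (ler_normB _ _))// (le_trans (lerD (ler_normB _ _) h1))//.
rewrite (le_trans (lerD (lerD h2 h4) (lexx _)))//.
have H (a b p : R) : 0 <= s * p ->
  B * s + K * s * a + B * s <= s * (p + (2 * B + K * a)) by lra.
by apply: H => //; rewrite mulr_ge0// ltW.
Qed.

(** [kappa] is an upper bound for [- F] times the derivative of [W] along [v], expressed through
    difference quotients because the weights are built from minima and maxima; [s * M] leaves room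
    for second-order remainders. *)
Lemma Rintegral_by_parts_le :
  \int[mu]_(y in O) (W y * dF y) <= \int[mu]_(y in O) kappa y.
Proof.
have [C dqC] := difference_quotient_bounded.
have [_ [Ck kC]] := bk.
(* In the layer where [y - s v] lies outside [O], the transposed quotient is only known to be at
   most [B]. Subtracting [B' (1 - l k y)] brings it below [kappa y + s M] there, and the layer
   disappears pointwise as [k] grows. *)
pose B' := B + (`|Ck| + `|M|).
have B'0 : 0 <= B' by rewrite addr_ge0// addr_ge0.
pose s (k : nat) : R := k.+1%:R^-1.
have s0 k : 0 < s k by rewrite invr_gt0.
pose b k y : R := (W y) * ((F \_ O) (y + s k *: v) - F y).
pose l k : 'rV[R]_n -> R := fun y => ((\1_O : 'rV[R]_n -> R) \_ O) (y - s k *: v).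
pose f k y := k.+1%:R * b k y - B' * (1 - l k y).
have bF0 := bounded_measurable_restrict bF.
have b1 : bm O (\1_O : 'rV[R]_n -> R).
  apply: (eq_bounded_measurable _ (bounded_measurable_cst _ 1)) => y Oy.
  by rewrite indicE mem_set.
have b10 := bounded_measurable_restrict b1.
have bb k : bm O (b k).
  apply: bounded_measurableM => //; apply: bounded_measurableB => //.
  exact: bounded_measurable_shift.
have bl k : bm O (l k) by exact: bounded_measurable_shift.
have bB1l k : bm O (fun y => B' * (1 - l k y)).
  apply: bounded_measurableZ; apply: bounded_measurableB => //.
  exact: bounded_measurable_cst.
have bf k : bm O (f k).
  by apply: bounded_measurableB => //; exact: bounded_measurableZ.
have l01 k y : 0 <= l k y <= 1.
  rewrite /l patchE; case: ifP => [|_]; last by rewrite lexx ler01.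
  by rewrite indicE => ->; rewrite ler01 lexx.
have fC k y : O y -> `|f k y| <= C + B'.
  move=> Oy; rewrite (le_trans (ler_normB _ _))// lerD//.
    rewrite normrM ger0_norm// -ler_pdivlMl// mulrC.
    by have := dqC _ y (s0 k) Oy; rewrite mulrC.
  have /andP[l0 l1] := l01 k y.
  by rewrite normrM (ger0_norm B'0) ger0_norm ?subr_ge0// ler_piMr// lerBlDr lerDl.
have cf y : O y -> f ^~ y @ \oo --> W y * dF y.
  move=> Oy; rewrite -[X in _ --> X]subr0.
  have -> : (f ^~ y) = (fun k => W y * (k.+1%:R * ((F \_ O) (y + s k *: v) - F y)) -
      B' * (1 - l k y)).
    by apply/funext => k; rewrite /f /b; congr (_ - _); ring.
  apply: cvgB.
    apply: cvgMr; apply: cvg_trans (difference_quotient_cvg (FdF Oy)).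
    apply: near_eq_cvg; have := shift_in_open v Oy; apply: filterS => k Ok.
    by rewrite patchE mem_set.
  apply: cvg_near_cst; have := shift_in_open (- v) Oy; apply: filterS => k Ok.
  by rewrite /l -scalerN patchE mem_set//= indicE mem_set//= subrr mulr0.
have cI := @bounded_Rintegral_cvg _ _ _ mu O mO finO f (fun y => W y * dF y) (C + B')
  (fun k => (bf k).1) (bounded_measurableM bW bdF).1 fC cf.
have f_le k : \int[mu]_(y in O) f k y <= \int[mu]_(y in O) kappa y +
    s k * (M * fine (mu O)).
  have -> : \int[mu]_(y in O) f k y =
      \int[mu]_(y in O) (k.+1%:R * (F y * (W \_ O) (y - s k *: v) - W y * F y) -
        B' * (1 - l k y)).
    have bW0 := bounded_measurable_restrict bW.
    have b1W := bounded_measurableM bW bF.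
    have b2W := bounded_measurableM bF (bounded_measurable_shift (- (s k *: v)) bW0).
    have b3W := bounded_measurableM (bounded_measurable_shift (s k *: v) bF0) bW.
    have e : \int[mu]_(y in O) b k y =
        \int[mu]_(y in O) (F y * (W \_ O) (y - s k *: v) - W y * F y).
      rewrite bounded_RintegralB// -(Rintegral_restrict_shift _ bF bW).
      rewrite -bounded_RintegralB//; apply: eq_Rintegral => y _.
      by rewrite /b mulrBr [W y * (F \_ O) _]mulrC.
    rewrite bounded_RintegralB//; last exact: bounded_measurableZ.
    rewrite [RHS]bounded_RintegralB//; last first.
      by apply: bounded_measurableZ; exact: bounded_measurableB.
    rewrite bounded_RintegralZ// e; congr (_ - _).
    by rewrite bounded_RintegralZ//; exact: bounded_measurableB.
  have -> : s k * (M * fine (mu O)) = \int[mu]_(y in O) (s k * M).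
    by rewrite Rintegral_cst// mulrA.
  have bcst := bounded_measurable_cst O (s k * M).
  rewrite -bounded_RintegralD//; apply: bounded_le_Rintegral => //.
  - apply: bounded_measurableB => //; apply: bounded_measurableZ.
    apply: bounded_measurableB; last exact: bounded_measurableM.
    apply: bounded_measurableM => //; apply: bounded_measurable_shift.
    exact: bounded_measurable_restrict.
  - exact: bounded_measurableD.
  move=> y Oy; rewrite /l !patchE; case: ifPn => [/set_mem Oys|/negP nOys].
    rewrite indicE mem_set// subrr mulr0 subr0 -ler_pdivlMl//.
    have := WF_le (s0 k) Oy Oys.
    by rewrite mulrBl [W (y - _) * F y]mulrC.
  have {}nOys : ~ O (y + (- s k) *: v).
    by rewrite scaleNr => h; apply: nOys; exact: mem_set.
  have := exitWF Oy nOys; rewrite normrN (gtr0_norm (s0 k)) => h.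
  rewrite (_ : point = 0 :> R)// mulr0 sub0r subr0 mulr1 lerBlDr.
  apply: (@le_trans _ _ B).
    rewrite -ler_pdivlMl// -/(s k) [s k * _]mulrC.
    by rewrite (le_trans _ h)// -normrN ler_norm.
  have h1 := kC _ Oy; rewrite ler_norml in h1; have /andP[h1' _] := h1.
  have h2 : - `|M| <= s k * M.
    have := ler_norm (- (s k * M)); rewrite normrN normrM gtr0_norm// => h2.
    have : s k * `|M| <= `|M| by rewrite ler_piMl// invf_le1// ler1n.
    by move: h2; lra.
  by have := ler_norm Ck; rewrite /B'; lra.
have c0 : (fun k => \int[mu]_(y in O) kappa y + s k * (M * fine (mu O))) @ \oo -->
    \int[mu]_(y in O) kappa y.
  rewrite -[X in _ --> X]addr0 -[X in _ --> _ + X](mul0r (M * fine (mu O))).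
  by apply: cvgD; [exact: cvg_cst|apply: cvgMl; exact: cvg_harmonic].
apply: ler_cvg_to cI c0 _.
exact: nearW.
Qed.

End integration_by_parts.

(** * Coordinates, the two norms, horizontal and vertical shifts *)

Section coordinates.
Context {R : realType}.

Local Notation e i := (delta_mx ord0 i).

Lemma coord_norm n (x : 'rV[R]_n) i : `|x ord0 i| <= `|x|.
Proof.
rewrite [leRHS]/Num.Def.normr /= mx_normrE.
exact: (@le_bigmax _ _ _ 0 (fun ij : 'I_1 * 'I_n => `|x ij.1 ij.2|) (ord0, i)).
Qed.

Lemma norm_rV_le n (x : 'rV[R]_n) (M : R) : 0 <= M ->
  (forall i, `|x ord0 i| <= M) -> `|x| <= M.
Proof.
move=> M0 xM; rewrite /Num.Def.normr /= mx_normrE; apply/bigmax_leP; split=> // -[i j] _ /=.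
by rewrite ord1; exact: xM.
Qed.

Lemma enorm_ge0 n (x : 'rV[R]_n) : 0 <= enorm x.
Proof. exact: sqrtr_ge0. Qed.

Lemma sqr_enorm n (x : 'rV[R]_n) : enorm x ^+ 2 = \sum_(i < n) x ord0 i ^+ 2.
Proof. by rewrite sqr_sqrtr// sumr_ge0// => i _; exact: sqr_ge0. Qed.

Lemma enorm_le n (x : 'rV[R]_n) : enorm x <= n%:R * `|x|.
Proof.
rewrite -(@ler_pXn2r _ 2)// ?nnegrE ?enorm_ge0 ?mulr_ge0// sqr_enorm.
apply: (@le_trans _ _ (\sum_(i < n) `|x| ^+ 2)).
  by apply: ler_sum => i _; rewrite -[leLHS]real_normK ?num_real// lerXn2r ?nnegrE ?coord_norm.
rewrite sumr_const card_ord -[leLHS]mulr_natl exprMn ler_wpM2r ?sqr_ge0//.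
by rewrite -natrX ler_nat; case: n {x} => // n; rewrite expnS leq_pmulr.
Qed.

Lemma delta_row n (i j : 'I_n) : (e i : 'rV[R]_n) ord0 j = (j == i)%:R.
Proof. by rewrite mxE eqxx. Qed.

Lemma xhead_shift0 n (x : 'rV[R]_n.+1) t : xhead (x + t *: e ord0) = xhead x + t.
Proof. by rewrite /xhead !mxE !eqxx mulr1. Qed.

Lemma xtail_shift0 n (x : 'rV[R]_n.+1) t : xtail (x + t *: e ord0) = xtail x.
Proof. by apply/rowP => j; rewrite !mxE eq_sym andbC /= mulr0 addr0. Qed.

Lemma xhead_shift n (x : 'rV[R]_n.+1) t i : i != ord0 ->
  xhead (x + t *: e i) = xhead x.
Proof. by move=> i0; rewrite /xhead !mxE eqxx eq_sym (negPf i0) mulr0 addr0. Qed.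

Lemma xtail_shift n (x : 'rV[R]_n.+1) t j :
  xtail (x + t *: e (lift ord0 j)) = xtail x + t *: e j.
Proof.
by apply/rowP => k; rewrite !mxE (inj_eq (@lift_inj _ ord0)).
Qed.

Lemma enorm_delta n (i : 'I_n) (t : R) : enorm (t *: e i) = `|t|.
Proof.
rewrite /enorm (bigD1 i)//= big1 => [|j ji]; last first.
  by rewrite mxE delta_row (negPf ji) mulr0 expr0n.
by rewrite mxE delta_row eqxx mulr1 addr0 sqrtr_sqr.
Qed.

Lemma continuous_xhead n : continuous (@xhead R n).
Proof. exact: coord_continuous. Qed.

Lemma continuous_rV n (T : topologicalType) (f : T -> 'rV[R]_n) :
  (forall i, continuous (fun t => f t ord0 i)) -> continuous f.
Proof.
move=> cf t; apply/cvgrPdist_le => eps eps0.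
have : \forall s \near t, forall i, `|f t ord0 i - f s ord0 i| <= eps.
  apply: filter_forall => i.
  by have /cvgrPdist_le := cf i t; exact.
apply: filterS => s fs; apply: norm_rV_le => [|i]; first exact: ltW.
by rewrite !mxE fs.
Qed.

Lemma continuous_xtail n : continuous (@xtail R n).
Proof.
apply: continuous_rV => i; under eq_fun do rewrite mxE.
exact: coord_continuous.
Qed.

End coordinates.

(** * Partial derivatives of a function that is smooth up to the closure *)

Section within_continuous.
Context {R : realType} {V : normedModType R}.

Lemma within_closure_continuous_at (O : set V) (g : V -> R) (x : V) :
  open O -> O x -> {within closure O, continuous g} -> {for x, continuous g}.
Proof.
move=> oO Ox /(continuous_subspaceW (@subset_closure _ O)).
by rewrite continuous_open_subspace// => /(_ x); apply; exact: mem_set.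
Qed.

End within_continuous.

Section regularity.
Context {R : realType} (n k : nat) (O : set 'rV[R]_n) (u : 'rV[R]_n -> R).
Hypotheses (oO : open O) (bO : bounded_set O) (Cu : Ck_closure k O u).

Lemma partials_continuous (s : seq 'I_n) x : (size s <= k)%N -> O x ->
  {for x, continuous (partials s u)}.
Proof.
case: Cu => _ _ /[apply] -[g cg ug] Ox.
have /(within_closure_continuous_at oO Ox) := cg.
move=> cgx; rewrite /prop_for /continuous_at ug//.
have E : \forall y \near x, g y = partials s u y.
  have : nbhs x O by exact: open_nbhs_nbhs.
  by apply: filterS => y Oy; rewrite ug.
exact: cvg_trans (near_eq_cvg E) cgx.
Qed.

(** The bound comes from the continuous extension to the closure, which is compact because [O] is
    bounded. *)
Lemma partials_bounded_measurable (s : seq 'I_n) : (size s <= k)%N ->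
  bounded_measurable O (partials s u).
Proof.
move=> sk; split.
  by apply: measurable_fun_open_rV => // x Ox; exact: partials_continuous.
case: Cu => _ _ /(_ _ sk)[g cg ug].
have bcO : bounded_set (closure O).
  have [M [_ /(_ (M + 1))]] := bO; rewrite ltrDl ltr01 => /(_ isT) OM.
  exists (M + 1); split; first exact: num_real.
  move=> N MN x clx; suff : closed_ball_ Num.norm 0 (M + 1) x.
    by rewrite /closed_ball_ /= sub0r normrN => /le_trans; apply; exact: ltW.
  have : closed (closed_ball_ Num.norm (0 : 'rV[R]_n) (M + 1)).
    exact: closed_closed_ball_.
  apply => //; apply: closure_subset clx => y /OM.
  by rewrite /closed_ball_ /= sub0r normrN.
have := continuous_compact cg (bounded_closed_compact bcO (@closed_closure _ O)).
move=> /compact_bounded[M [_ /(_ (M + 1))]]; rewrite ltrDl ltr01 => /(_ isT) gM.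
exists (M + 1) => x Ox; rewrite ug//; apply: gM.
by exists x => //; exact: subset_closure.
Qed.

Lemma partials_is_derive (s : seq 'I_n) i x : (size s < k)%N -> O x ->
  is_derive x (delta_mx ord0 i) (partials s u) (partials (i :: s) u x).
Proof. by case: Cu => du _ _ sk Ox; apply: derivableP; exact: du. Qed.

Lemma partials_comm (s : seq 'I_n) i j x : ((size s).+2 <= k)%N -> O x ->
  partials (i :: j :: s) u x = partials (j :: i :: s) u x.
Proof.
move=> sk Ox.
apply: (@is_derive_comm _ _ O (partials s u) (partials (j :: s) u)
  (partials (i :: s) u) _ _ x (delta_mx ord0 j) (delta_mx ord0 i)) => //.
- by move=> y Oy; split; apply: partials_is_derive => //; exact: ltnW.
- by move=> y Oy; split; apply: partials_is_derive.
- exact: partials_continuous.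
- exact: partials_continuous.
Qed.

End regularity.

(** * Geometry of the subgraph and the ways of leaving it *)

Section subgraph_domain.
Context {R : realType} (n : nat).
Variables (omega : set 'rV[R]_n.+1) (phi : 'rV[R]_n.+1 -> R) (L H h : R).
Local Notation Omega := (subgraph omega phi).
Local Notation e i := (delta_mx ord0 i).
Hypotheses (oomega : open omega) (bomega : bounded_set omega).
Hypotheses (L0 : 0 <= L) (h0 : 0 < h).
Hypothesis phi_bound : forall x, omega x -> h <= phi x <= H.
Hypothesis phi_lip : forall x y, omega x -> omega y ->
  `|phi x - phi y| <= L * enorm (x - y).

(** The distance, inside [Omega], to the ends of the vertical fibre through [x]. It does not see the
    lateral boundary, where [u] and its vertical derivative become small instead. *)
Definition depth (x : 'rV[R]_n.+2) : R :=
  Num.min (xhead x) (phi (xtail x) - xhead x).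

Lemma depth_le x : depth x <= xhead x /\ depth x <= phi (xtail x) - xhead x.
Proof. by rewrite /depth !ge_min !lexx orbT. Qed.

Lemma subgraph_depth x : omega (xtail x) -> 0 < depth x -> Omega x.
Proof.
move=> ox; rewrite /depth lt_min => /andP[x0 xphi]; split => //.
by rewrite x0 -subr_gt0.
Qed.

Lemma depth_gt0 x : Omega x -> 0 < depth x.
Proof. by move=> [_ /andP[x0 xphi]]; rewrite /depth lt_min x0 subr_gt0. Qed.

Lemma continuous_phi x : omega x -> {for x, continuous phi}.
Proof.
move=> ox; apply: (@cvgrPdist_le _ _ _ (nbhs x) _ phi (phi x)).2 => eps eps0.
have C0 : 0 < L * n.+1%:R + 1 by rewrite ltr_wpDl// mulr_ge0.
have nx : nbhs x (ball x (eps / (L * n.+1%:R + 1))).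
  by apply: nbhsx_ballx; rewrite divr_gt0.
have no : nbhs x omega by exact: open_nbhs_nbhs.
apply: filterS2 nx no => y xy oy; rewrite (le_trans (phi_lip ox oy))//.
rewrite (le_trans (ler_wpM2l L0 (enorm_le _)))// mulrA.
rewrite -ball_normE /ball_ /= ltr_pdivlMr// in xy.
rewrite (le_trans _ (ltW xy))// mulrC ler_wpM2l//.
by rewrite lerDl.
Qed.

Lemma continuous_phi_xtail x : Omega x -> {for x, continuous (phi \o @xtail R n.+1)}.
Proof.
move=> [ox _]; apply: continuous_comp; first exact: continuous_xtail.
exact: continuous_phi.
Qed.

Lemma continuous_depth x : Omega x -> {for x, continuous depth}.
Proof.
move=> Ox; apply: (@continuous_min _ _ (@xhead R n.+1)
  (fun x => phi (xtail x) - xhead x)); first exact: continuous_xhead.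
exact: cvgB (continuous_phi_xtail Ox) (@continuous_xhead _ _ x).
Qed.

Lemma open_subgraph : open Omega.
Proof.
rewrite openE => x Ox.
have nx : \forall y \near x, 0 < depth y.
  exact: (continuous_depth Ox (lt_nbhsr (depth_gt0 Ox))).
have no : \forall y \near x, omega (xtail y).
  by apply: continuous_xtail; apply: open_nbhs_nbhs; split => //; case: Ox.
by apply: filterS2 nx no => y d0 oy; exact: subgraph_depth.
Qed.

Lemma bounded_subgraph : bounded_set Omega.
Proof.
have [M [_ /(_ (`|M| + 1))]] := bomega.
have M1 : M < `|M| + 1 by rewrite (le_lt_trans (ler_norm M))// ltrDl.
move=> /(_ M1) oM; exists (`|M| + 1 + `|H|); split; first exact: num_real.
move=> N MN x [ox /andP[x0 xphi]].
have N1 : `|M| + 1 <= N by rewrite (le_trans _ (ltW MN))// lerDl.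
have N2 : `|H| <= N by rewrite (le_trans _ (ltW MN))// lerDr.
apply: norm_rV_le => [|i]; first exact: le_trans (normr_ge0 _) N2.
case: (unliftP ord0 i) => [j|] ->.
  have -> : x ord0 (lift ord0 j) = xtail x ord0 j by rewrite mxE.
  by rewrite (le_trans (coord_norm _ _))// (le_trans _ N1)//; exact: oM.
rewrite -/(xhead x) gtr0_norm// (le_trans (ltW xphi))//.
have /andP[_ phiH] := phi_bound ox.
by rewrite (le_trans phiH)// (le_trans (ler_norm _)).
Qed.

Lemma phi_shift_lip (x : 'rV[R]_n.+2) i (t : R) : i != ord0 ->
  omega (xtail x) -> omega (xtail (x + t *: e i)) ->
  `|phi (xtail (x + t *: e i)) - phi (xtail x)| <= L * `|t|.
Proof.
case: (unliftP ord0 i) => [j ->|-> /eqP//] _; rewrite xtail_shift => ox oxt.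
rewrite (le_trans (phi_lip oxt ox))// [xtail x + _]addrC addrK.
by rewrite enorm_delta.
Qed.

Lemma depth_shift_ge (x : 'rV[R]_n.+2) i (t : R) : i != ord0 ->
  omega (xtail x) -> omega (xtail (x + t *: e i)) ->
  depth x - L * `|t| <= depth (x + t *: e i).
Proof.
move=> i0 ox oxt; have := phi_shift_lip i0 ox oxt.
have [] := depth_le x; have : 0 <= L * `|t| by rewrite mulr_ge0.
rewrite [depth (x + _)]/depth xhead_shift// le_min.
have A (p q a d l : R) : 0 <= l -> d <= a -> d <= p - a -> `|q - p| <= l ->
    (d - l <= a) && (d - l <= q - a).
  by rewrite ler_norml => ? ? ? /andP[? ?]; apply/andP; split; lra.
exact: A.
Qed.

Lemma depth_lip (x : 'rV[R]_n.+2) i (t : R) :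
  omega (xtail x) -> omega (xtail (x + t *: e i)) ->
  `|depth (x + t *: e i) - depth x| <= (1 + L) * `|t|.
Proof.
have B (a a' b b' l : R) : `|a' - a| <= l -> `|b' - b| <= l ->
    `|Num.min a' b' - Num.min a b| <= l.
  rewrite !ler_norml => /andP[a1 a2] /andP[b1 b2].
  by rewrite !minElt; case: ifP; case: ifP; lra.
have t0 : `|t| <= (1 + L) * `|t| by rewrite mulrDl mul1r lerDl mulr_ge0.
have Lt : L * `|t| <= (1 + L) * `|t| by rewrite mulrDl mul1r lerDr.
have [->|i0] := eqVneq i ord0.
  rewrite /depth xtail_shift0 xhead_shift0 => _ _; apply: B.
    by rewrite addrAC subrr add0r.
  by rewrite (_ : _ - _ = - t) ?normrN//; ring.
move=> ox oxt; rewrite /depth xhead_shift//; apply: B.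
  by rewrite subrr normr0 mulr_ge0// addr_ge0.
have := phi_shift_lip i0 ox oxt.
rewrite (_ : phi _ - _ - _ = phi (xtail (x + t *: e i)) - phi (xtail x)); last by ring.
by move=> /le_trans; apply.
Qed.

(** A line may leave [Omega] and come back, so an outer end point says little by itself; the first
    exit, at time [t'], is a boundary point reached from inside. *)
Lemma exit_point (x v : 'rV[R]_n.+2) (t : R) : Omega x -> ~ Omega (x + t *: v) ->
  exists t' : R, [/\ `|t'| <= `|t|, ~ Omega (x + t' *: v) &
    forall b : R, 0 <= b < 1 -> Omega (x + (b * t') *: v)].
Proof.
move=> Ox nO; have [c [/andP[c0 c1] nOc Ob]] := exit_time open_subgraph Ox nO.
exists (c * t); split => //.
  by rewrite normrM gtr0_norm// ler_piMl.
move=> b /andP[b0 b1]; rewrite mulrA; apply: Ob.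
by rewrite mulr_ge0 ?(ltW c0)//= gtr_pMl.
Qed.

Lemma exit_head (x : 'rV[R]_n.+2) (t : R) : Omega x -> ~ Omega (x + t *: e ord0) -> depth x <= `|t|.
Proof.
move=> [ox _] nO; rewrite leNgt; apply/negP => td; apply: nO.
apply: subgraph_depth; first by rewrite xtail_shift0.
move: td; rewrite /depth xhead_shift0 xtail_shift0 !lt_min !ltr_norml.
have C (p a : R) : (- a < t < a) && (- (p - a) < t < p - a) ->
    (0 < a + t) && (0 < p - (a + t)).
  by move=> /andP[/andP[? ?] /andP[? ?]]; apply/andP; split; lra.
exact: C.
Qed.

(** A horizontal move that stays over [omega] can only leave through the graph, whose height changes
    by at most [L |t|]. *)
Lemma exit_side (x : 'rV[R]_n.+2) i (t : R) : i != ord0 -> Omega x ->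
  omega (xtail (x + t *: e i)) ->
  ~ Omega (x + t *: e i) ->
  phi (xtail (x + t *: e i)) <= xhead x /\ depth x <= L * `|t|.
Proof.
move=> i0 [ox /andP[x0 xphi]] oxt nO.
have ph : phi (xtail (x + t *: e i)) <= xhead x.
  rewrite leNgt; apply/negP => xp; apply: nO; split => //.
  by rewrite xhead_shift// x0.
split => //; have := phi_shift_lip i0 ox oxt; have [_] := depth_le x.
have D (p q a d l : R) : d <= p - a -> `|q - p| <= l -> q <= a -> d <= l.
  by rewrite ler_norml => ? /andP[? ?] ?; lra.
by move=> d1 d2; exact: D d1 d2 ph.
Qed.

Section lateral_vanishing.
Variable u : 'rV[R]_n.+2 -> R.
Hypotheses (Cu : Ck_closure 3 Omega u).
Hypothesis u0 : forall x, lateral_bdry omega Omega x -> u x = 0.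
Variable B : R.
Hypothesis B0 : 0 <= B.
Hypothesis uB : forall s x, (0 < size s <= 2)%N -> Omega x -> `|partials s u x| <= B.

Lemma partials_line_lip s (x : 'rV[R]_n.+2) i (t : R) : (size s <= 1)%N ->
  (forall c : R, 0 <= c <= 1 -> Omega (x + (c * t) *: e i)) ->
  `|partials s u (x + t *: e i) - partials s u x| <= B * `|t|.
Proof.
move=> s1 Ox; apply: lipschitz_line => c c01.
  exact: (@ex_derive _ _ _ _ _ _ _ (partials_is_derive Cu i (leq_trans s1 _) (Ox _ c01))).
by apply: (uB (s := i :: s)) => //; exact: Ox.
Qed.

(** The end point is a limit of points of [Omega] and its tail is not in [omega]: it lies on the
    lateral boundary, where [u] is [0]. The conclusion is about inner points since derivatives are
    bounded only inside. *)
Lemma lateral_bdry_limit (x : 'rV[R]_n.+2) i (t : R) :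
  (forall b : R, 0 <= b < 1 -> Omega (x + (b * t) *: e i)) ->
  ~ omega (xtail (x + t *: e i)) ->
  forall eps : R, 0 < eps ->
  exists b : R, [/\ 0 <= b < 1 & `|u (x + (b * t) *: e i)| < eps].
Proof.
move=> Ob no eps eps0; set p := x + t *: e i.
pose b (k : nat) : R := 1 - k.+1%:R^-1.
have b01 k : 0 <= b k < 1.
  by rewrite subr_ge0 invf_le1// ler1n/= ltrBlDr ltrDl invr_gt0.
have cb : (fun k => x + (b k * t) *: e i : 'rV[R]_n.+2) @ \oo --> p.
  have : (fun k => x + ((1 - k.+1%:R^-1) * t) *: e i : 'rV[R]_n.+2) @ \oo -->
     x + ((1 - 0) * t) *: (e i : 'rV[R]_n.+2).
    apply: cvgD; first exact: cvg_cst.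
    apply: cvgZr_tmp; apply: cvgMl; apply: cvgB; first exact: cvg_cst.
    exact: cvg_harmonic.
  by rewrite subr0 mul1r.
have clp : closure Omega p.
  move=> U /cb [k _ /(_ k (leqnn k)) Uk].
  by exists (x + (b k * t) *: e i); split => //; exact: Ob.
have nOp : ~ Omega p by move=> [].
have bp : lateral_bdry omega Omega p.
  split; split => //.
  - by move=> /interior_subset.
  - move=> U /(@continuous_xtail R _ p) Up.
    have [y [Oy Uy]] := clp _ Up.
    by exists (xtail y); split => //; case: Oy.
  - by move=> /interior_subset.
have [_ /subspace_continuousP /(_ p clp) cu _] := Cu.
have cup : nbhs p [set y | closure Omega y -> ball (u p) eps (u y)].
  exact: cu _ (nbhsx_ballx _ _ eps0).
have [k _ /(_ k (leqnn k)) uk] := cb _ cup; exists (b k); split; first exact: b01.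
have := uk (subset_closure (Ob _ (b01 k))).
by rewrite u0// -ball_normE /ball_ /= sub0r normrN.
Qed.

Lemma lateral_exit_u (x : 'rV[R]_n.+2) i (t : R) :
  (forall b : R, 0 <= b < 1 -> Omega (x + (b * t) *: e i)) ->
  ~ omega (xtail (x + t *: e i)) -> `|u x| <= B * `|t|.
Proof.
move=> Ob no; apply/ler_addgt0Pr => eps eps0.
have [b [b01 ub]] := lateral_bdry_limit Ob no eps0.
have /andP[b0 b1] := b01.
have ulip : `|u (x + (b * t) *: e i) - u x| <= B * `|b * t|.
  apply: (@partials_line_lip [::]) => // c /andP[c0 c1]; rewrite mulrA.
  by apply: Ob; rewrite mulr_ge0//= (le_lt_trans _ b1)// ler_piMl.
rewrite (_ : u x = u (x + (b * t) *: e i) - (u (x + (b * t) *: e i) - u x));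
  last by ring.
rewrite (le_trans (ler_normB _ _))// (le_trans (lerD (ltW ub) ulip))//.
rewrite [leRHS]addrC lerD2l ler_wpM2l// normrM (ger0_norm b0) ler_piMl//.
exact: ltW.
Qed.

(* On the lateral boundary u vanishes on vertical segments, hence so does its
   vertical derivative; the quantitative form compares u at two points at
   vertical distance sg, and lets sg tend to 0. *)
Lemma lateral_exit_partial x i t : i != ord0 -> Omega x ->
  ~ Omega (x + t *: e i) ->
  depth x <= L * `|t| \/ `|partial ord0 u x| <= B * `|t|.
Proof.
move=> i0 Ox nO.
have [t' [tt' nO' Ob]] := exit_point Ox nO.
have Ltt' : L * `|t'| <= L * `|t| by rewrite ler_wpM2l.
have Btt' : B * `|t'| <= B * `|t| by rewrite ler_wpM2l.
have [ot|no] := pselect (omega (xtail (x + t' *: e i))).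
  by left; have [_ /le_trans] := exit_side i0 Ox ot nO'; apply.
have [dx|dx] := leP (depth x) (L * `|t'|); first by left; exact: le_trans Ltt'.
right; apply: le_trans Btt'; apply/ler_addgt0Pr => eps eps0.
pose dl := depth x - L * `|t'|.
have dl0 : 0 < dl by rewrite subr_gt0.
(* [sg < dl] keeps vertical segments of length [sg] inside [Omega] during the whole horizontal
   motion; the other bound makes the final error [3 B sg] at most [eps]. *)
pose sg := Num.min (dl / 2) (eps / (3 * B + 1)).
have B31 : 0 < 3 * B + 1 by rewrite ltr_wpDl// mulr_ge0.
have sg0 : 0 < sg by rewrite lt_min !divr_gt0.
have sgdl : sg < dl.
  rewrite (@le_lt_trans _ _ (dl / 2))// ?ge_min ?lexx//.
  by rewrite ltr_pdivrMr// ltr_pMr// ltr1n.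
have sgeps : 3 * B * sg <= eps.
  have : sg <= eps / (3 * B + 1) by rewrite ge_min lexx orbT.
  rewrite ler_pdivlMr// => h1; rewrite (le_trans _ h1)// mulrC.
  by rewrite ler_wpM2l ?(ltW sg0)// lerDl.
(* [q] stops short of the exit point by [r |t'| <= sg^2]: both values of [u] on the vertical segment
   are then at most [B sg^2], still [O(sg)] after division by [sg]. *)
pose r := Num.min 1 (sg ^+ 2 / (`|t'| + 1)).
have t1 : 0 < `|t'| + 1 by rewrite ltr_wpDl.
have r0 : 0 < r by rewrite lt_min ltr01 divr_gt0// exprn_gt0.
have r1 : r <= 1 by rewrite ge_min lexx.
have rsg : r * `|t'| <= sg ^+ 2.
  have : r <= sg ^+ 2 / (`|t'| + 1) by rewrite ge_min lexx orbT.
  rewrite ler_pdivlMr// => h1; rewrite (le_trans _ h1)//.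
  by rewrite ler_wpM2l ?(ltW r0)// lerDl.
pose q := x + ((1 - r) * t') *: e i.
have Ok (c b : R) : 0 <= c <= 1 -> 0 <= b < 1 ->
    Omega (x + (b * t') *: e i + (c * sg) *: e ord0).
  move=> /andP[c0 c1] b01; have Oy := Ob _ b01.
  set y := x + _ in Oy *; have [oy _] := Oy.
  have dy : sg < depth y.
    rewrite (lt_le_trans sgdl)// /dl (le_trans _ (depth_shift_ge i0 _ _))//.
      rewrite lerB// ler_wpM2l// normrM; case/andP: b01 => b0 b1.
      by rewrite (ger0_norm b0) ler_piMl// ltW.
    by case: Ox.
  have [d1 d2] := depth_le y; split; first by rewrite xtail_shift0.
  rewrite xhead_shift0 xtail_shift0.
  have csg : 0 <= c * sg <= sg.
    by rewrite mulr_ge0 ?(ltW sg0)//= ler_piMl// ltW.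
  have A (d p a s z : R) : 0 < s -> s < d -> d <= a -> d <= p - a ->
      0 <= z <= s -> 0 < a + z < p.
    by move=> ? ? ? ? /andP[? ?]; apply/andP; split; lra.
  exact: A sg0 dy d1 d2 csg.
have i00 : 0 <= (0 : R) <= 1 by rewrite lexx ler01.
have i11 : 0 <= (1 : R) <= 1 by rewrite lexx ler01.
have r01 : 0 <= 1 - r < 1 by rewrite subr_ge0 r1/= ltrBlDr ltrDl.
have br b : 0 <= b < 1 -> 0 <= (1 - r) + b * r < 1.
  move=> /andP[b0 b1]; rewrite addr_ge0 ?mulr_ge0 ?subr_ge0 ?(ltW r0)//=.
  by rewrite addrAC ltrBlDr ltrD2l gtr_pMl.
have uq c : 0 <= c <= 1 -> `|u (q + (c * sg) *: e ord0)| <= B * sg ^+ 2.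
  move=> c01; rewrite (@le_trans _ _ (B * `|r * t'|))//.
    apply: (@lateral_exit_u _ i) => [b b01|].
      rewrite (_ : q + _ + _ = x + ((1 - r + b * r) * t') *: e i +
        (c * sg) *: e ord0); first by apply: Ok => //; exact: br.
      by rewrite [(_ + b * r) * _]mulrDl [(_ + _) *: e i]scalerDl mulrA addrA [LHS]addrAC.
    rewrite (_ : q + _ + _ = x + t' *: e i + (c * sg) *: e ord0).
      by rewrite xtail_shift0.
    by rewrite /q addrAC -(addrA x) -scalerDl -mulrDl subrK mul1r.
  by rewrite ler_wpM2l// normrM (gtr0_norm r0).
have Oq c : 0 <= c <= 1 -> Omega (q + (c * sg) *: e ord0).
  by move=> c01; exact: Ok.
have q0 : q + (0 * sg) *: e ord0 = q by rewrite mul0r scale0r addr0.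
have u0q := uq _ i00; rewrite q0 in u0q.
have u1q := uq _ i11; rewrite mul1r in u1q.
have [c c01 uc] : exists2 c : R, 0 <= c <= 1 &
    u (q + sg *: e ord0) - u q = sg * partial ord0 u (q + (c * sg) *: e ord0).
  apply: MVT_line => c c01.
  exact: (@ex_derive _ _ _ _ _ _ _ (partials_is_derive Cu ord0 (s := [::]) isT (Oq _ c01))).
have vq : `|partial ord0 u (q + (c * sg) *: e ord0) - partial ord0 u q| <= B * sg.
  have /andP[c0 c1] := c01.
  rewrite (@le_trans _ _ (B * `|c * sg|))//.
    apply: (@partials_line_lip [:: ord0]) => // a /andP[a0 a1]; rewrite mulrA.
    by apply: Oq; rewrite mulr_ge0//= (le_trans _ c1)// ler_piMl.
  by rewrite ler_wpM2l// normrM (ger0_norm c0) (gtr0_norm sg0) ler_piMl// ltW.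
have vx : `|partial ord0 u q - partial ord0 u x| <= B * `|t'|.
  rewrite (@le_trans _ _ (B * `|(1 - r) * t'|))//.
    apply: (@partials_line_lip [:: ord0]) => // a /andP[a0 a1]; rewrite mulrA.
    have /andP[r2 r3] := r01.
    by apply: Ob; rewrite mulr_ge0//= (le_lt_trans _ r3)// ler_piMl.
  have /andP[r2 r3] := r01.
  by rewrite ler_wpM2l// normrM (ger0_norm r2) ler_piMl// ltW.
(* The error adds up [2 B sg] for the quotient of [u], [B sg] from the mean value point down to [q],
   and [B |t'|] from [q] back to [x]. *)
have D (vc w z u1 v T : R) : u1 - v = sg * vc -> `|vc - w| <= B * sg ->
    `|w - z| <= B * T -> `|v| <= B * sg ^+ 2 -> `|u1| <= B * sg ^+ 2 ->
    3 * B * sg <= eps -> `|z| <= B * T + eps.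
  move=> E; rewrite !ler_norml.
  move=> /andP[a1 a2] /andP[b1 b2] /andP[c1 c2] /andP[d1 d2] h1.
  have vcB : - (2 * B * sg) <= vc <= 2 * B * sg.
    rewrite -(ler_pM2l sg0) -[X in _ && X](ler_pM2l sg0) -E.
    by apply/andP; split; lra.
  by case/andP: vcB => ? ?; apply/andP; split; lra.
exact: D uc vq vx u0q u1q sgeps.
Qed.

End lateral_vanishing.
End subgraph_domain.

(** * The two-sided integration by parts, from [F] and [- F] *)

Section by_parts_abs.
Context {R : realType} (n : nat).
Local Notation mu := (@lebesgue_rV R n).
Variables (O : set 'rV[R]_n) (v : 'rV[R]_n).
Hypotheses (oO : open O) (finO : (mu O < +oo)%E).
Variables (F dF W kappa : 'rV[R]_n -> R) (B K M : R).
Hypotheses (bF : bounded_measurable O F) (bdF : bounded_measurable O dF).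
Hypotheses (bW : bounded_measurable O W) (bk : bounded_measurable O kappa).
Hypotheses (B0 : 0 <= B) (K0 : 0 <= K).
Hypothesis FdF : forall y, O y -> is_derive y v F (dF y).
Hypothesis lipW : forall y (t : R), O y -> O (y + t *: v) ->
  `|W (y + t *: v) - W y| <= K * `|t|.
Hypothesis exitWF : forall y (t : R), O y -> ~ O (y + t *: v) ->
  `|W y * F y| <= B * `|t|.
Hypothesis WF_le : forall y (s : R), 0 < s -> O y -> O (y - s *: v) ->
  `|(W (y - s *: v) - W y) * F y| <= s * (kappa y + s * M).

Lemma normr_Rintegral_by_parts_le :
  `|\int[mu]_(y in O) (W y * dF y)| <= \int[mu]_(y in O) kappa y.
Proof.
have mO := measurable_open_rV oO.
rewrite ler_norml lerNl; apply/andP; split; last first.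
  apply: (Rintegral_by_parts_le oO finO bF bdF bW bk B0 K0 FdF lipW exitWF (M := M)).
  by move=> y s s0 Oy Oys; rewrite (le_trans (ler_norm _))// WF_le.
rewrite -mulN1r -bounded_RintegralZ//; last exact: bounded_measurableM.
under eq_Rintegral do rewrite mulN1r -mulrN.
apply: (@Rintegral_by_parts_le _ _ _ v oO finO (fun y => - F y) _ _ _ B K M) => //.
- exact: bounded_measurableN.
- exact: bounded_measurableN.
- by move=> y Oy; have := FdF Oy => ?; exact: is_deriveN.
- by move=> y t Oy nO; rewrite mulrN normrN exitWF.
- move=> y s s0 Oy Oys; rewrite mulrN (le_trans (ler_norm _))// normrN.
  exact: WF_le.
Qed.

End by_parts_abs.

(** * The weights [tent] and [ramp] *)

Section tent.
Context {R : realType} (n : nat).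
Implicit Types x : 'rV[R]_n.+1.
Local Notation e i := (delta_mx ord0 i).

Definition tent (h : R) x : R := Num.max 0 (Num.min (xhead x) (h - xhead x)).

Lemma tent_ge0 h x : 0 <= tent h x.
Proof. by rewrite le_max lexx. Qed.

Lemma tent_le h x : 0 <= h -> tent h x <= h.
Proof.
move=> h0; rewrite ge_max h0/= ge_min; apply/orP.
by have [hx|xh] := leP h (xhead x); [right|left; exact: ltW]; lra.
Qed.

Lemma tent_shift h x (t : R) i : i != ord0 -> tent h (x + t *: e i) = tent h x.
Proof. by move=> i0; rewrite /tent xhead_shift. Qed.

Lemma tent_lip h x (t : R) : `|tent h (x + t *: e ord0) - tent h x| <= `|t|.
Proof.
rewrite /tent xhead_shift0; move: (xhead x) => a.
rewrite !ler_norml; have [t0|t0] := leP 0 t; rewrite ?(ger0_norm t0) ?(ltr0_norm t0);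
rewrite !maxElt !minElt; case: ifP => [|/negbT]; case: ifP => [|/negbT];
  case: ifP => [|/negbT]; case: ifP => [|/negbT]; rewrite -?leNgt => *;
  apply/andP; split; lra.
Qed.

Lemma continuous_tent h : continuous (tent h).
Proof.
move=> x; apply: (@continuous_max _ _ (fun=> 0)
  (fun x => Num.min (xhead x) (h - xhead x))); first exact: cst_continuous.
apply: (@continuous_min _ _ (@xhead R n) (fun x => h - xhead x)).
  exact: continuous_xhead.
exact: cvgB (@cvg_cst _ h _ (nbhs x) _) (@continuous_xhead R n x).
Qed.

End tent.

Section ramp.
Context {R : realType}.
Implicit Types h m p s t : R.

(** Equal to [0] up to [h / 4] and to [1] from [3 h / 4] on, with slope [2 / h] in between. *)
Definition ramp h t : R := Num.max 0 (Num.min 1 (2 * t / h - 1 / 2)).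

Lemma ramp01 h t : 0 <= ramp h t <= 1.
Proof. by rewrite le_max lexx/= ge_max ler01 ge_min lexx. Qed.

Lemma continuous_ramp h : continuous (ramp h).
Proof.
move=> t; apply: (@continuous_max _ _ (fun=> 0)
  (fun t => Num.min 1 (2 * t / h - 1 / 2))); first exact: cst_continuous.
apply: (@continuous_min _ _ (fun=> 1) (fun t => 2 * t / h - 1 / 2)).
  exact: cst_continuous.
apply: (@cvgB _ _ _ _ _ (fun t => 2 * t / h) (fun=> 1 / 2)); last exact: cvg_cst.
by apply: cvgMl; apply: cvgMr; exact: cvg_id.
Qed.

Lemma ramp_lip h t s : 0 < h -> `|ramp h (t + s) - ramp h t| <= 2 / h * `|s|.
Proof.
move=> h0; rewrite /ramp (_ : 2 * (t + s) / h - _ =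
  2 * t / h - 1 / 2 + 2 / h * s); last by field; exact: lt0r_neq0.
have -> : 2 / h * `|s| = `|2 / h * s|.
  by rewrite normrM (gtr0_norm (divr_gt0 _ _)).
move: (2 * t / h - _) (2 / h * s) => c d.
rewrite !ler_norml; have [d0|d0] := leP 0 d; rewrite ?(ger0_norm d0) ?(ltr0_norm d0);
rewrite !maxElt !minElt; case: ifP => [|/negbT]; case: ifP => [|/negbT];
  case: ifP => [|/negbT]; case: ifP => [|/negbT]; rewrite -?leNgt => *;
  apply/andP; split; lra.
Qed.

(** The increment is at most [2 s / h], and positive only if [t > h / 4] and [t - s < 3 h / 4]. In
    that case the tent at [t], plus [s], is at least [h / 4], so the last factor is at least [1]. *)
Lemma ramp_diff_le h t s : 0 < h -> 0 < s ->
  ramp h t - ramp h (t - s) <=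
  2 / h * s * (4 / h * (Num.max 0 (Num.min t (h - t)) + s)).
Proof.
move=> h0 s0.
pose c := 2 * t / h - 1 / 2; pose d := 2 / h * s.
have d0 : 0 < d by rewrite mulr_gt0// divr_gt0.
have rt : ramp h t = Num.max 0 (Num.min 1 c) by [].
have rts : ramp h (t - s) = Num.max 0 (Num.min 1 (c - d)).
  rewrite /ramp (_ : 2 * (t - s) / h - _ = c - d)//.
  by rewrite /c /d; field; exact: lt0r_neq0.
have k0 : 0 < 4 / h by rewrite divr_gt0.
pose x := 4 / h * Num.max 0 (Num.min t (h - t)).
have x0 : 0 <= x by rewrite mulr_ge0 ?(ltW k0)// le_max lexx.
have xc : Num.min (2 * c + 1) (3 - 2 * c) <= x.
  rewrite (_ : 2 * c + 1 = 4 / h * t); last by rewrite /c; field; exact: lt0r_neq0.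
  rewrite (_ : 3 - 2 * c = 4 / h * (h - t)); last by rewrite /c; field; exact: lt0r_neq0.
  rewrite -minr_pMr ?(ltW k0)// ler_pM2l//.
  by rewrite le_max lexx orbT.
rewrite mulrDr -/x rt rts -/d (_ : 4 / h * s = 2 * d); last by rewrite /d; ring.
have A : 0 <= d * (x + 2 * d).
  apply: mulr_ge0; first exact: ltW.
  by apply: addr_ge0 => //; apply: mulr_ge0 => //; exact: ltW.
have [c0|c0] := leP c 0.
  rewrite (le_trans _ A)// subr_le0 (max_l (_ : Num.min 1 c <= 0)).
    by rewrite le_max lexx.
  by rewrite ge_min c0 orbT.
have [c1|c1] : 1 <= c - d \/ c - d < 1 by case: (leP 1 (c - d)); [left|right].
  have -> : Num.max 0 (Num.min 1 (c - d)) = 1.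
    by rewrite (_ : Num.min 1 (c - d) = 1) ?max_r//; exact: min_l.
  by rewrite (le_trans _ A)// subr_le0 ge_max ler01 ge_min lexx.
have x1 : 1 <= x + 2 * d.
  have : 1 - 2 * d <= Num.min (2 * c + 1) (3 - 2 * c).
    by rewrite le_min; apply/andP; split; lra.
  by move: xc; lra.
apply: (@le_trans _ _ d); last by rewrite ler_peMr// ltW.
rewrite lerBlDr; move: c0 c1 d0; clear; move: c d => c d.
rewrite !maxElt !minElt; case: ifP => [|/negbT]; case: ifP => [|/negbT];
  case: ifP => [|/negbT]; case: ifP => [|/negbT]; rewrite -?leNgt => *; lra.
Qed.

(** Where the ramp is constant, the left-hand side is the distance to one end of []0, p[]. In
    between, both ends are at distance at least [h / 4], while the left-hand side is at most
    [p <= m h]. *)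
Lemma ramp_dist_le h m p t : 0 < h -> 1 <= m -> h <= p <= m * h -> 0 < t < p ->
  `|t - p * ramp h t| <= 4 * m * Num.min t (p - t).
Proof.
move=> h0 m1 /andP[hp pm] /andP[t0 tp].
have m0 : 0 < m by lra.
have mmin (q : R) : 0 <= q -> q <= 4 * m * q by move=> ?; nra.
have [t1|t1] := leP t (h / 4).
  have -> : ramp h t = 0.
    apply/max_l; rewrite ge_min; apply/orP; right.
    by rewrite subr_le0 ler_pdivrMr//; lra.
  rewrite mulr0 subr0 gtr0_norm// min_l; last by lra.
  exact: mmin (ltW t0).
have ph4 : 0 <= p - t by lra.
have [t2|t2] := leP (3 * h / 4) t.
  have -> : ramp h t = 1.
    rewrite /ramp min_l ?max_r//.
    by rewrite lerBrDr ler_pdivlMr//; lra.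
  rewrite mulr1 distrC ger0_norm//; rewrite minElt; case: ifP => _.
    by nra.
  exact: mmin.
have /andP[r0 r1] := ramp01 h t.
have hd : h <= 4 * Num.min t (p - t).
  by rewrite -ler_pdivrMl// le_min; apply/andP; split; lra.
apply: (@le_trans _ _ p).
  by rewrite ler_norml; apply/andP; split; nra.
rewrite (le_trans pm)// (mulrC 4) -mulrA ler_wpM2l//.
exact: ltW.
Qed.

End ramp.

(** * The weighted energy inequality *)

Section energy.
Context {R : realType} (n : nat).
Local Notation mu := (@lebesgue_rV R n).
Local Notation bm := (bounded_measurable (R := R)).
Variables (O : set 'rV[R]_n).
Hypotheses (oO : open O) (finO : (mu O < +oo)%E).
Variables (a : 'M[R]_n) (lambda : R).
Hypothesis elliptic : forall xi : 'rV[R]_n, lambda * enorm xi ^+ 2 <=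
  \sum_(i < n) \sum_(j < n) a i j * xi ord0 i * xi ord0 j.
Variables (w : 'rV[R]_n -> R) (dw : 'I_n -> 'rV[R]_n -> R)
  (ddw : 'I_n -> 'I_n -> 'rV[R]_n -> R) (W : 'rV[R]_n -> R).
Hypotheses (bw : bm O w) (bdw : forall i, bm O (dw i))
  (bddw : forall i j, bm O (ddw i j)) (bW : bm O W).
Hypothesis W0 : forall x, O x -> 0 <= W x.
Hypothesis Lw0 : forall x, O x -> \sum_(i < n) \sum_(j < n) a i j * ddw i j x = 0.

(** [dw i * dw j + w * ddw i j] stands for the [i]-th derivative of [w w_j], the form that can be
    integrated by parts; summed against [a], its second half vanishes by the equation and its first
    half is bounded below by ellipticity. *)
Lemma energy_le :
  lambda * \int[mu]_(x in O) (W x * \sum_(i < n) dw i x ^+ 2) <=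
  \sum_(i < n) \sum_(j < n)
    a i j * \int[mu]_(x in O) (W x * (dw i x * dw j x + w x * ddw i j x)).
Proof.
have mO := measurable_open_rV oO.
have bij i j : bm O (fun x => W x * (dw i x * dw j x + w x * ddw i j x)).
  apply: bounded_measurableM => //; apply: bounded_measurableD => //;
  exact: bounded_measurableM.
have bij' i j : bm O (fun x => a i j * (W x * (dw i x * dw j x + w x * ddw i j x))).
  exact: bounded_measurableZ.
under eq_bigr do under eq_bigr do rewrite -bounded_RintegralZ//.
under eq_bigr do rewrite -bounded_Rintegral_sum//.
rewrite -bounded_Rintegral_sum//; last first.
  by move=> i; exact: bounded_measurable_sum.
have bdw2 : bm O (fun x => W x * \sum_(i < n) dw i x ^+ 2).
  apply: bounded_measurableM => //; apply: bounded_measurable_sum => i.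
  exact: bounded_measurableX.
rewrite -bounded_RintegralZ//; apply: bounded_le_Rintegral => //.
- exact: bounded_measurableZ.
- by apply: bounded_measurable_sum => i; exact: bounded_measurable_sum.
move=> x Ox.
have -> : \sum_(i < n) \sum_(j < n)
      a i j * (W x * (dw i x * dw j x + w x * ddw i j x)) =
    W x * \sum_(i < n) \sum_(j < n) a i j * dw i x * dw j x.
  transitivity (\sum_(i < n) (W x * (\sum_(j < n) a i j * dw i x * dw j x) +
      W x * w x * (\sum_(j < n) a i j * ddw i j x))).
    apply: eq_bigr => i _; rewrite !mulr_sumr -big_split/=.
    by apply: eq_bigr => j _; ring.
  by rewrite big_split/= -!mulr_sumr Lw0// mulr0 addr0.
rewrite mulrCA ler_wpM2l ?W0//.
have := elliptic (\row_i dw i x); rewrite sqr_enorm.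
under eq_bigr do rewrite mxE.
by under [X in _ <= X]eq_bigr do under eq_bigr do rewrite !mxE.
Qed.

End energy.

(** * The weighted estimates on [Omega] *)

Section estimates.
Context {R : realType} (n : nat).
Variables (omega : set 'rV[R]_n.+1) (phi : 'rV[R]_n.+1 -> R) (L H h : R).
Local Notation Omega := (subgraph omega phi).
Local Notation mu := (@lebesgue_rV R n.+2).
Local Notation bm := (bounded_measurable (R := R)).
Local Notation e i := (delta_mx ord0 i).
Hypotheses (oomega : open omega) (bomega : bounded_set omega).
Hypotheses (L0 : 0 <= L) (h0 : 0 < h) (hH : h <= H).
Hypothesis phi_bound : forall x, omega x -> h <= phi x <= H.
Hypothesis phi_lip : forall x y, omega x -> omega y ->
  `|phi x - phi y| <= L * enorm (x - y).
Variable u : 'rV[R]_n.+2 -> R.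
Hypotheses (Cu : Ck_closure 3 Omega u).
Hypothesis u0 : forall x, lateral_bdry omega Omega x -> u x = 0.
Variables (a : 'M[R]_n.+2) (lambda Lambda : R).
Hypothesis lambda0 : 0 < lambda.
Hypothesis elliptic : forall xi : 'rV[R]_n.+2, lambda * enorm xi ^+ 2 <=
  \sum_(i < n.+2) \sum_(j < n.+2) a i j * xi ord0 i * xi ord0 j.
Hypothesis a_le : forall j, \sum_(i < n.+2) `|a i j| <= Lambda.
Hypothesis Lu0 : forall x, Omega x -> const_op a u x = 0.

Let oOmega : open Omega := open_subgraph oomega L0 phi_lip.
Let bOmega : bounded_set Omega := bounded_subgraph bomega phi_bound.
Let mOmega : measurable Omega := measurable_open_rV oOmega.
Let finOmega : (mu Omega < +oo)%E := lebesgue_rV_bounded mOmega bOmega.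

Let bmP s : (size s <= 3)%N -> bm Omega (partials s u).
Proof. exact: partials_bounded_measurable. Qed.

Lemma partials_bound : exists2 B : R, 0 <= B &
  forall s x, (0 < size s <= 2)%N -> Omega x -> `|partials s u x| <= B.
Proof.
have /choice[b bP] (s : seq 'I_n.+2) : exists b : R, 0 <= b /\
    ((size s <= 3)%N -> forall x, Omega x -> `|partials s u x| <= b).
  have [s3|s3] := leqP (size s) 3; last by exists 0.
  by have [M M0 uM] := bounded_measurable_bound (bmP s3); exists M.
exists (\sum_i b [:: i] + \sum_i \sum_j b [:: i; j]).
  rewrite addr_ge0// sumr_ge0// => [i|i] _; first by case: (bP [:: i]).
  by rewrite sumr_ge0// => j _; case: (bP [:: i; j]).
have S1 i : b [:: i] <= \sum_i b [:: i].
  by rewrite (bigD1 i)//= lerDl sumr_ge0// => j _; case: (bP [:: j]).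
have S2 i j : b [:: i; j] <= \sum_i \sum_j b [:: i; j].
  rewrite (bigD1 i)//= (bigD1 j)//= -addrA lerDl addr_ge0// sumr_ge0// => k _.
    by case: (bP [:: i; k]).
  by rewrite sumr_ge0// => l _; case: (bP [:: k; l]).
have P1 : 0 <= \sum_i b [:: i] by rewrite sumr_ge0// => j _; case: (bP [:: j]).
have P2 : 0 <= \sum_i \sum_j b [:: i; j].
  by rewrite sumr_ge0// => i _; rewrite sumr_ge0// => j _; case: (bP [:: i; j]).
case=> [//|i [|j [|//]]] x _ Ox.
  have [_ /(_ isT _ Ox) h1] := bP [:: i].
  by rewrite (le_trans h1)// (le_trans (S1 i))// lerDl.
have [_ /(_ isT _ Ox) h1] := bP [:: i; j].
by rewrite (le_trans h1)// (le_trans (S2 i j))// lerDr.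
Qed.

Lemma is_derive_mul_partials s t i x : (size s < 3)%N -> (size t < 3)%N ->
  Omega x ->
  is_derive x (e i) (fun y => partials s u y * partials t u y)
   (partials (i :: s) u x * partials t u x + partials s u x * partials (i :: t) u x).
Proof.
move=> s3 t3 Ox.
have ds := partials_is_derive Cu i s3 Ox.
have dt := partials_is_derive Cu i t3 Ox.
apply: is_derive_eq (is_deriveM ds dt) _.
by rewrite addrC; congr (_ + _); exact: mulrC.
Qed.

Lemma phi_le_H x : Omega x -> h <= phi (xtail x) <= H.
Proof. by case=> ox _; exact: phi_bound. Qed.

Lemma bounded_measurable_continuous (f : 'rV[R]_n.+2 -> R) M :
  (forall x, Omega x -> {for x, continuous f}) ->
  (forall x, Omega x -> `|f x| <= M) -> bm Omega f.
Proof.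
move=> cf fM; split; last by exists M.
exact: measurable_fun_open_rV.
Qed.

(** * The energy of [u] under the tent *)

Lemma bm_tent : bm Omega (tent h).
Proof.
apply: (@bounded_measurable_continuous _ h) => x _; first exact: continuous_tent.
by rewrite ger0_norm ?tent_ge0// tent_le// ltW.
Qed.

Lemma tent_le_depth x : Omega x -> tent h x <= depth phi x.
Proof.
move=> Ox; have /andP[hphi _] := phi_le_H Ox.
rewrite ge_max ltW ?(depth_gt0 Ox)//= /depth le_min !ge_min lexx/=.
by rewrite lerD2r hphi orbT.
Qed.

Lemma bm_mul_partials s t i : (size s < 3)%N -> (size t < 3)%N ->
  bm Omega (fun x => partials (i :: s) u x * partials t u x +
    partials s u x * partials (i :: t) u x).
Proof.
move=> s3 t3; apply: bounded_measurableD; apply: bounded_measurableM;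
  by apply: bmP => //; exact: ltnW.
Qed.

(** An exit through the graph happens at height at least [h], where the tent is [0]; any other
    horizontal exit is lateral, where [u] is small. *)
Lemma exit_tent_u x i t : i != ord0 -> Omega x -> ~ Omega (x + t *: e i) ->
  forall B : R, 0 <= B ->
  (forall s x, (0 < size s <= 2)%N -> Omega x -> `|partials s u x| <= B) ->
  `|tent h x * u x| <= h * (B * `|t|).
Proof.
move=> i0 Ox nO B B0 uB.
have [t' [tt' nO' Ob]] := exit_point oomega L0 phi_lip Ox nO.
have [ot|no] := pselect (omega (xtail (x + t' *: e i))).
  have [hx _] := exit_side phi_lip i0 Ox ot nO'.
  have /andP[h1 _] := phi_bound ot.
  suff -> : tent h x = 0 by rewrite mul0r normr0 !mulr_ge0// ltW.
  apply/eqP; rewrite eq_le tent_ge0 ge_max lexx ge_min/=.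
  by rewrite [h - _ <= 0]subr_le0 (le_trans h1 hx) orbT.
rewrite normrM; apply: ler_pM => //.
  by rewrite ger0_norm ?tent_ge0// tent_le// ltW.
apply: le_trans (lateral_exit_u Cu u0 B0 uB Ob no) _.
by rewrite ler_wpM2l.
Qed.

Let T1 i j := \int[mu]_(x in Omega) (tent h x *
  (partials [:: i] u x * partials [:: j] u x + u x * partials [:: i; j] u x)).

(** The integrand is the tent times the [i]-th derivative of [u u_j], and the tent is constant in
    that direction, so [kappa] can be [0]. *)
Lemma tent_by_parts_side i j : i != ord0 -> T1 i j = 0.
Proof.
move=> i0; have [B B0 uB] := partials_bound.
have b0 : bm Omega (fun=> 0) by exact: bounded_measurable_cst.
apply/eqP; rewrite -normr_le0.
apply: (@le_trans _ _ (\int[mu]_(x in Omega) 0)); last first.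
  by rewrite Rintegral_cst// mul0r.
apply: (@normr_Rintegral_by_parts_le _ _ _ (e i) oOmega finOmega
  (fun x => u x * partials [:: j] u x) _ _ _ (h * B * B) 0 0) => //.
- by apply: bounded_measurableM; [exact: (@bmP [::])|exact: bmP].
- exact: (@bm_mul_partials [::] [:: j]).
- exact: bm_tent.
- by rewrite !mulr_ge0// ltW.
- by move=> y Oy; exact: (@is_derive_mul_partials [::] [:: j]).
- by move=> y t _ _; rewrite tent_shift// subrr normr0 mul0r.
- move=> y t Oy nO; rewrite mulrA normrM.
  rewrite (@le_trans _ _ (h * (B * `|t|) * B))//.
    by rewrite ler_pM ?(exit_tent_u i0 Oy nO)// (uB [:: j]).
  by rewrite le_eqVlt; apply/orP; left; apply/eqP; ring.
- move=> y s s0 Oy _; rewrite -scaleNr tent_shift// subrr mul0r normr0.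
  by rewrite mulr0 addr0 mulr0.
Qed.

(** In the vertical direction the tent has slope at most [1], and it is dominated by the depth,
    hence by [|t|] whenever a move by [t] leaves [Omega]. *)
Lemma tent_by_parts_head :
  `|T1 ord0 ord0| <= \int[mu]_(x in Omega) `|u x * partial ord0 u x|.
Proof.
have bF : bm Omega (fun x => u x * partials [:: ord0] u x).
  by apply: bounded_measurableM; [exact: (@bmP [::])|exact: bmP].
have [CF CF0 FC] := bounded_measurable_bound bF.
apply: (@normr_Rintegral_by_parts_le _ _ _ (e ord0) oOmega finOmega
  (fun x => u x * partials [:: ord0] u x) _ _ _ CF 1 0) => //.
- exact: (@bm_mul_partials [::] [:: ord0]).
- exact: bm_tent.
- exact: bounded_measurable_norm.
- by move=> y Oy; exact: (@is_derive_mul_partials [::] [:: ord0]).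
- by move=> y t _ _; rewrite mul1r tent_lip.
- move=> y t Oy nO; rewrite normrM mulrC ler_pM// ?FC// ger0_norm ?tent_ge0//.
  exact: le_trans (tent_le_depth Oy) (exit_head Oy nO).
- move=> y s s0 Oy _; rewrite mulr0 addr0 normrM ler_wpM2r// -scaleNr.
  by rewrite (le_trans (tent_lip _ _ _))// normrN gtr0_norm.
Qed.

Lemma tent_energy :
  lambda * \int[mu]_(x in Omega) (tent h x * \sum_(i < n.+2) partial i u x ^+ 2) <=
  Lambda * \int[mu]_(x in Omega) `|u x * partial ord0 u x|.
Proof.
apply: le_trans (energy_le oOmega finOmega elliptic (w := u)
  (dw := fun i => partials [:: i] u) (ddw := fun i j => partials [:: i; j] u)
  (@bmP [::] isT) (fun i => @bmP [:: i] isT) (fun i j => @bmP [:: i; j] isT)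
  bm_tent (fun x _ => tent_ge0 h x) Lu0) _.
(* Second derivatives commute, so this integrand is also a derivative in the horizontal direction
   [j]; only [T1 ord0 ord0] survives, whether or not [a] is symmetric. *)
have T0j j : j != ord0 -> T1 ord0 j = 0.
  move=> j0; rewrite -(tent_by_parts_side ord0 j0); apply: eq_Rintegral => x.
  move=> /set_mem Ox; rewrite [partials [:: ord0] u x * _]mulrC.
  by rewrite (@partials_comm _ _ _ _ _ oOmega Cu [::]).
rewrite (bigD1 ord0)//= [X in _ + X]big1 ?addr0 => [|i i0]; last first.
  by apply: big1 => j _; rewrite [X in _ * X](tent_by_parts_side j i0) mulr0.
rewrite (bigD1 ord0)//= [X in _ + X]big1 ?addr0 => [|j j0]; last first.
  by rewrite [X in _ * X](T0j _ j0) mulr0.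
rewrite (le_trans (ler_norm _))// normrM ler_pM//; last exact: tent_by_parts_head.
by rewrite (le_trans _ (a_le ord0))// (bigD1 ord0)//= lerDl sumr_ge0.
Qed.

(** * The energy of [v] with weight [depth ^+ 2] *)

Lemma bm_depth : bm Omega (depth phi).
Proof.
apply: (@bounded_measurable_continuous _ H) => x Ox.
  exact: (continuous_depth oomega L0 phi_lip Ox).
have [ox /andP[x0 xphi]] := Ox; have /andP[_ pH] := phi_bound ox.
rewrite gtr0_norm ?(depth_gt0 Ox)//; have [d1 d2] := depth_le phi x.
by rewrite (le_trans d1)// (le_trans (ltW xphi)).
Qed.

Lemma depth_leH x : Omega x -> 0 <= depth phi x <= H.
Proof.
move=> Ox; have [ox /andP[x0 xphi]] := Ox; have /andP[_ pH] := phi_bound ox.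
rewrite ltW ?(depth_gt0 Ox)//=; have [d1 d2] := depth_le phi x.
by rewrite (le_trans d1)// (le_trans (ltW xphi)).
Qed.

(** The coefficients are constant, so the equation may be differentiated in [x_1]; the derivative in
    [x_1] is then moved to the innermost place. *)
Lemma const_op_partial x : Omega x ->
  \sum_(i < n.+2) \sum_(j < n.+2) a i j * partials [:: i; j; ord0] u x = 0.
Proof.
move=> Ox; have nO : nbhs x Omega by exact: open_nbhs_nbhs.
have comm i j : partials [:: i; j; ord0] u x = partials [:: ord0; i; j] u x.
  (* The inner exchange is needed on a neighbourhood, because the outer derivative is applied to
     it. *)
  have E : \forall y \near x, partials [:: j; ord0] u y = partials [:: ord0; j] u y.
    by apply: filterS nO => y Oy; exact: (partials_comm oOmega Cu (s := [::]) j ord0 isT Oy).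
  transitivity (partials [:: i; ord0; j] u x).
    exact: (near_eq_derive (e i) E).
  exact: (partials_comm oOmega Cu (s := [:: j]) i ord0 isT Ox).
have dL : is_derive x (e ord0) (const_op a u)
    (\sum_(i < n.+2) \sum_(j < n.+2) a i j * partials [:: ord0; i; j] u x).
  have d2 i j : is_derive x (e ord0) (fun y => a i j * partials [:: i; j] u y)
      (a i j * partials [:: ord0; i; j] u x).
    apply: is_deriveZ; exact: (@partials_is_derive _ _ _ _ _ Cu [:: i; j]).
  have d1 i : is_derive x (e ord0) (fun y => \sum_(j < n.+2) a i j * partials [:: i; j] u y)
      (\sum_(j < n.+2) a i j * partials [:: ord0; i; j] u x).
    rewrite (_ : (fun _ => _) = \sum_(j < n.+2) (fun y => a i j * partials [:: i; j] u y)).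
      exact: is_derive_sum.
    by apply/funext => y; rewrite fct_sumE.
  rewrite (_ : const_op a u = \sum_(i < n.+2)
      (fun y => \sum_(j < n.+2) a i j * partials [:: i; j] u y)).
    exact: is_derive_sum.
  by apply/funext => y; rewrite fct_sumE.
under eq_bigr do under eq_bigr do rewrite comm.
have d0 : is_derive x (e ord0) (const_op a u) 0.
  have E0 : \forall y \near x, cst 0 y = const_op a u y.
    by apply: filterS nO => y Oy; rewrite Lu0.
  exact: near_eq_is_derive E0 (is_derive_cst _ _ _).
by rewrite -(@derive_val _ _ _ _ _ _ _ dL) (@derive_val _ _ _ _ _ _ _ d0).
Qed.

Local Notation v := (partials [:: ord0] u).
Let T2 i j := \int[mu]_(x in Omega) (depth phi x ^+ 2 *
  (partials [:: i; ord0] u x * partials [:: j; ord0] u x +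
   v x * partials [:: i; j; ord0] u x)).

(** [2 (1 + L) depth] bounds the slope of [depth ^+ 2]. Leaving through the bottom or the graph
    makes the depth [O(|t|)], leaving through the lateral boundary makes [v] [O(|t|)], so the
    product is small near the whole boundary. *)
Lemma depth_by_parts i j : `|T2 i j| <= \int[mu]_(x in Omega)
  (2 * (1 + L) * (depth phi x * `|v x * partials [:: j; ord0] u x|)).
Proof.
have [B B0 uB] := partials_bound.
have bF : bm Omega (fun x => v x * partials [:: j; ord0] u x).
  by apply: bounded_measurableM; exact: bmP.
have [CF CF0 FC] := bounded_measurable_bound bF.
have L1 : 0 <= 1 + L by rewrite addr_ge0.
have H0 : 0 <= H := le_trans (ltW h0) hH.
(* The exit constant adds the bounds for the two kinds of exit; [2 H (1 + L)] is a Lipschitz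
   constant of [depth ^+ 2], and [(1 + L)^2 CF] bounds the quadratic remainder of its increments
   times [F]. *)
apply: (@normr_Rintegral_by_parts_le _ _ _ (e i) oOmega finOmega
  (fun x => v x * partials [:: j; ord0] u x) _ _ _
  (H * ((1 + L) * CF) + H * H * (B * B)) (2 * H * (1 + L)) ((1 + L) ^+ 2 * CF)) => //.
- exact: (@bm_mul_partials [:: ord0] [:: j; ord0]).
- by apply: bounded_measurableX; exact: bm_depth.
- apply: bounded_measurableZ; apply: bounded_measurableM; first exact: bm_depth.
  exact: bounded_measurable_norm.
- by rewrite addr_ge0 ?mulr_ge0.
- by rewrite !mulr_ge0.
- by move=> y Oy; exact: (@is_derive_mul_partials [:: ord0] [:: j; ord0]).
- move=> y t Oy Oyt; have := depth_lip L0 phi_lip Oy.1 Oyt.1.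
  have /andP[d0 dH] := depth_leH Oy; have /andP[d0' dH'] := depth_leH Oyt.
  rewrite subr_sqr normrM => dl.
  have dd : `|depth phi (y + t *: e i) + depth phi y| <= 2 * H.
    by rewrite ger0_norm ?addr_ge0// mulr_natl mulr2n lerD.
  rewrite (le_trans (ler_pM _ _ dl dd))//.
  by rewrite le_eqVlt; apply/orP; left; apply/eqP; ring.
- move=> y t Oy nO; have /andP[d0 dH] := depth_leH Oy.
  have Fy := FC _ Oy; have t0 := normr_ge0 t.
  have case1 : depth phi y <= (1 + L) * `|t| ->
      `|depth phi y ^+ 2 * (v y * partials [:: j; ord0] u y)| <=
      (H * ((1 + L) * CF) + H * H * (B * B)) * `|t|.
    move=> dt; rewrite normrM normrX ger0_norm//.
    rewrite (@le_trans _ _ (H * ((1 + L) * `|t|) * CF))//.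
      by rewrite ler_pM ?sqr_ge0// expr2 ler_pM.
    rewrite [leRHS]mulrDl (_ : H * _ * CF = H * ((1 + L) * CF) * `|t|); last by ring.
    by rewrite lerDl !mulr_ge0.
  have [i0|i0] := eqVneq i ord0.
    rewrite i0 in nO; apply: case1; rewrite (le_trans (exit_head Oy nO))//.
    by rewrite mulrDl mul1r lerDl mulr_ge0.
  have [dt|vt] := lateral_exit_partial oomega L0 phi_lip Cu u0 B0 uB i0 Oy nO.
    by apply: case1; rewrite (le_trans dt)// mulrDl mul1r lerDr.
  rewrite normrM normrX ger0_norm// normrM.
  rewrite (@le_trans _ _ (H * H * ((B * `|t|) * B)))//.
    rewrite ler_pM ?sqr_ge0 ?mulr_ge0//.
      by rewrite expr2 ler_pM.
    by rewrite ler_pM// (uB [:: j; ord0]).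
  rewrite [leRHS]mulrDl (_ : H * H * (B * `|t| * B) = H * H * (B * B) * `|t|); last by ring.
  by rewrite lerDr !mulr_ge0.
- move=> y s s0 Oy; rewrite -scaleNr => Oys.
  have := depth_lip L0 phi_lip Oy.1 Oys.1.
  have /andP[d0 dH] := depth_leH Oy; have /andP[d0' dH'] := depth_leH Oys.
  have Fy := FC _ Oy; rewrite normrN (gtr0_norm s0) => dl.
  rewrite normrM subr_sqr normrM.
  have dd : `|depth phi (y + - s *: e i) + depth phi y| <=
      2 * depth phi y + (1 + L) * s.
    rewrite ger0_norm ?addr_ge0//.
    have A (p q l : R) : `|p - q| <= l -> p + q <= 2 * q + l.
      by rewrite ler_norml => /andP[? ?]; lra.
    exact: A.
  rewrite (le_trans (ler_wpM2r _ (ler_pM _ _ dl dd)))//.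
  move: Fy; move: `|v y * _| (normr_ge0 (v y * partials [:: j; ord0] u y)) => f f0 fC.
  rewrite (_ : _ * f = s * (2 * (1 + L) * (depth phi y * f) + s * ((1 + L) ^+ 2 * f)));
    last by ring.
  by rewrite ler_wpM2l ?(ltW s0)// lerD2l ler_wpM2l ?(ltW s0)// ler_wpM2l ?sqr_ge0.
Qed.

(** A Caccioppoli inequality: AM-GM splits each cross term, and the parts with [v_j] add up to half
    of the left-hand side, where they are absorbed. The factor [n.+2] counts the indices [j], each
    of which costs one multiple of the integral of [v^2]. *)
Lemma depth_energy :
  \int[mu]_(x in Omega) (depth phi x ^+ 2 * \sum_(i < n.+2) partials [:: i; ord0] u x ^+ 2) <=
  n.+2%:R * (4 * (1 + L) ^+ 2 * Lambda ^+ 2 / lambda ^+ 2) * \int[mu]_(x in Omega) v x ^+ 2.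
Proof.
set E := \int[mu]_(x in _) _; set V := \int[mu]_(x in _) _.
have L1 : 0 <= 1 + L by rewrite addr_ge0.
have bE : bm Omega (fun x => depth phi x ^+ 2 *
    \sum_(i < n.+2) partials [:: i; ord0] u x ^+ 2).
  apply: bounded_measurableM; first exact/bounded_measurableX/bm_depth.
  by apply: bounded_measurable_sum => i; apply: bounded_measurableX; exact: bmP.
have bEj j : bm Omega (fun x => depth phi x ^+ 2 * partials [:: j; ord0] u x ^+ 2).
  apply: bounded_measurableM; first exact/bounded_measurableX/bm_depth.
  by apply: bounded_measurableX; exact: bmP.
have bV : bm Omega (fun x => v x ^+ 2).
  by apply: bounded_measurableX; exact: bmP.
have bS j : bm Omega (fun x =>
    2 * (1 + L) * (depth phi x * `|v x * partials [:: j; ord0] u x|)).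
  apply: bounded_measurableZ; apply: bounded_measurableM; first exact: bm_depth.
  by apply: bounded_measurable_norm; apply: bounded_measurableM; exact: bmP.
pose S j := \int[mu]_(x in Omega)
  (2 * (1 + L) * (depth phi x * `|v x * partials [:: j; ord0] u x|)).
have S0 j : 0 <= S j.
  apply: Rintegral_ge0 => x Ox; have /andP[d0 _] := depth_leH Ox.
  by rewrite !mulr_ge0.
have EsumE : E = \sum_j \int[mu]_(x in Omega)
    (depth phi x ^+ 2 * partials [:: j; ord0] u x ^+ 2).
  rewrite /E -bounded_Rintegral_sum//; apply: eq_Rintegral => x _.
  by rewrite mulr_sumr.
have h1 : lambda * E <= Lambda * \sum_j S j.
  apply: le_trans (energy_le oOmega finOmega elliptic (w := v)
    (dw := fun i => partials [:: i; ord0] u)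
    (ddw := fun i j => partials [:: i; j; ord0] u) (W := fun x => depth phi x ^+ 2)
    (@bmP [:: ord0] isT) (fun i => @bmP [:: i; ord0] isT)
    (fun i j => @bmP [:: i; j; ord0] isT) (bounded_measurableX 2 bm_depth)
    (fun x _ => sqr_ge0 _) const_op_partial) _.
  (* The bound [S j] depends on [j] only, and [a_le] bounds the columns of [a], so the sum over [i]
     is taken first. *)
  rewrite exchange_big mulr_sumr/=; apply: ler_sum => j _.
  rewrite (@le_trans _ _ (\sum_i `|a i j| * S j))//; last first.
    by rewrite -mulr_suml ler_wpM2r.
  apply: ler_sum => i _; rewrite (le_trans (ler_norm _))// normrM ler_wpM2l//.
  exact: depth_by_parts.
(* AM-GM with [K := 1 + L]: [2 K Lambda d `|v v_j|] is at most
   [lambda / 2 (d v_j)^2 + 2 K^2 Lambda^2 / lambda v^2]. *)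
have h2 j : Lambda * S j <= (lambda / 2) *
    (\int[mu]_(x in Omega) (depth phi x ^+ 2 * partials [:: j; ord0] u x ^+ 2)) +
    (2 * (1 + L) ^+ 2 * Lambda ^+ 2 / lambda) * V.
  rewrite /V -!bounded_RintegralZ// -bounded_RintegralD//;
    try exact: bounded_measurableZ.
  apply: bounded_le_Rintegral => //; try exact: bounded_measurableZ.
    by apply: bounded_measurableD; exact: bounded_measurableZ.
  move=> x Ox; have /andP[d0 _] := depth_leH Ox; rewrite normrM.
  rewrite -[v x ^+ 2]real_normK ?num_real//.
  rewrite -[partials [:: j; _] u x ^+ 2]real_normK ?num_real//.
  have A (k d p q : R) : Lambda * (2 * k * (d * (p * q))) <=
      lambda / 2 * (d ^+ 2 * q ^+ 2) + 2 * k ^+ 2 * Lambda ^+ 2 / lambda * p ^+ 2.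
    rewrite -subr_ge0 (_ : _ - _ =
        (lambda / 2) * (d * q - 2 * k * Lambda / lambda * p) ^+ 2).
      by rewrite mulr_ge0 ?sqr_ge0// divr_ge0// ltW.
    by field; exact: lt0r_neq0.
  exact: A.
have h3 : Lambda * \sum_j S j <= (lambda / 2) * E +
    n.+2%:R * ((2 * (1 + L) ^+ 2 * Lambda ^+ 2 / lambda) * V).
  rewrite mulr_sumr EsumE mulr_sumr; apply: (le_trans (ler_sum _ (fun j _ => h2 j))).
  by rewrite big_split/= sumr_const card_ord -[X in _ + X <= _]mulr_natl.
have := le_trans h1 h3; move: E V {h1 h2 h3 EsumE} => E V.
have A (k : R) : lambda * E <= lambda / 2 * E + n.+2%:R * ((2 * k / lambda) * V) ->
    E <= n.+2%:R * (4 * k / lambda ^+ 2) * V.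
  move=> h1; rewrite -(@ler_pM2l _ (lambda / 2)) ?divr_gt0//.
  rewrite (_ : lambda / 2 * (_ * V) = n.+2%:R * ((2 * k / lambda) * V)); last first.
    by field; exact: lt0r_neq0.
  by move: h1; lra.
by rewrite -[4 * _ * _]mulrA -[2 * _ * _]mulrA; exact: A.
Qed.

(** * The Hardy inequality on vertical fibres and the gradient bound *)

Variable m : R.
Hypotheses (m1 : 1 <= m) (Hm : H <= m * h).

(* For fixed x', theta vanishes at both ends of the fibre ]0, phi x'[, has slope
   1 near them and a negative slope only where tent is bounded below. *)
Let theta (x : 'rV[R]_n.+2) := xhead x - phi (xtail x) * ramp h (xhead x).

Lemma theta_le x : Omega x -> `|theta x| <= 4 * m * depth phi x.
Proof.
move=> [ox xx]; apply: ramp_dist_le => //.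
by have /andP[-> /le_trans] := phi_bound ox; apply.
Qed.

Lemma bm_theta : bm Omega theta.
Proof.
apply: (@bounded_measurable_continuous _ (4 * m * H)) => x Ox; last first.
  rewrite (le_trans (theta_le Ox))// ler_wpM2l ?mulr_ge0 ?(le_trans ler01 m1)//.
  by have /andP[] := depth_leH Ox.
have cr : {for x, continuous (ramp h \o @xhead R n.+1)}.
  by apply: continuous_comp; [exact: continuous_xhead|exact: continuous_ramp].
have cp : {for x, continuous (phi \o @xtail R n.+1)}.
  exact: (continuous_phi_xtail oomega L0 phi_lip Ox).
exact: continuousB (@continuous_xhead R n.+1 x) (continuousM cp cr).
Qed.

(** Moving down by [s] contributes [- s] plus [phi] times an increment of the ramp; with
    [phi <= m h] and [ramp_diff_le], the factor is [m h * (2 / h) * (4 / h) = 8 m / h]. *)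
Lemma theta_shift_le x s : 0 < s -> Omega x ->
  theta (x - s *: e ord0) - theta x <=
  s * (8 * m / h * tent h x - 1 + s * (8 * m / h)).
Proof.
move=> s0 Ox; have /andP[hp pH] := phi_le_H Ox.
have A (X p r r' T : R) : 0 < p -> p <= m * h -> 0 <= T ->
    r - r' <= 2 / h * s * (4 / h * (T + s)) ->
    X - s - p * r' - (X - p * r) <= s * (8 * m / h * T - 1 + s * (8 * m / h)).
  move=> p0 pm T0 rr.
  rewrite (_ : X - s - p * r' - (X - p * r) = p * (r - r') - s); last by ring.
  rewrite lerBlDr.
  rewrite (_ : s * _ + s = m * h * (2 / h * s * (4 / h * (T + s)))); last first.
    by field; exact: lt0r_neq0.
  apply: (le_trans (ler_wpM2l (ltW p0) rr)); rewrite ler_wpM2r//.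
  have k0 (c : R) : 0 <= c -> 0 <= c / h by move=> ?; rewrite divr_ge0// ltW.
  apply: mulr_ge0; first by apply: mulr_ge0; [exact: k0|exact: ltW].
  by apply: mulr_ge0; [exact: k0|apply: addr_ge0 => //; exact: ltW].
rewrite /theta -scaleNr xhead_shift0 xtail_shift0.
apply: A; [exact: lt_le_trans hp|exact: le_trans Hm|exact: tent_ge0|].
exact: ramp_diff_le.
Qed.

Lemma theta_lip x (t : R) : Omega x ->
  `|theta (x + t *: e ord0) - theta x| <= (1 + H * (2 / h)) * `|t|.
Proof.
move=> Ox; have /andP[hp pH] := phi_le_H Ox.
rewrite /theta xhead_shift0 xtail_shift0.
rewrite (_ : _ - _ = t - phi (xtail x) * (ramp h (xhead x + t) - ramp h (xhead x)));
  last by ring.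
rewrite (le_trans (ler_normB _ _))// mulrDl mul1r lerD2l normrM -mulrA.
by apply: ler_pM => //; [rewrite ger0_norm// (le_trans _ hp)// ltW|exact: ramp_lip].
Qed.

(** The [-1] in the slope bound for [theta] produces the integral of [u_j^2]. Nothing is assumed of
    [u_j] on the boundary: vertical moves leave [Omega] only through the ends of a fibre, where
    [theta] is small. *)
Lemma fibre_hardy j :
  \int[mu]_(x in Omega) partial j u x ^+ 2 <=
  16 * m / h * \int[mu]_(x in Omega) (tent h x * partial j u x ^+ 2) +
  64 * m ^+ 2 * \int[mu]_(x in Omega) (depth phi x ^+ 2 * partials [:: j; ord0] u x ^+ 2).
Proof.
have conclude (k c p q r s t : R) : s <= t -> 2^-1 * p <= k * q + 32 * c * r + (s - t) ->
  p <= 2 * k * q + 64 * c * r by lra.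
have kE : 16 * m / h = 2 * (8 * m / h) by ring.
have m0 : 0 <= m by exact: le_trans m1.
have H0 : 0 <= H := le_trans (ltW h0) hH.
have c0 : 0 <= 8 * m / h by rewrite divr_ge0 ?mulr_ge0// ltW.
pose w := partials [:: j] u.
have bw : bm Omega w by exact: bmP.
have bF : bm Omega (fun x => w x * w x) by exact: bounded_measurableM.
have bt : bm Omega (fun x => tent h x * w x ^+ 2).
  by apply: bounded_measurableM; [exact: bm_tent|exact: bounded_measurableX].
have bd : bm Omega (fun x => depth phi x ^+ 2 * partials [:: j; ord0] u x ^+ 2).
  apply: bounded_measurableM; apply: bounded_measurableX; [exact: bm_depth|exact: bmP].
have bk : bm Omega (fun x => (8 * m / h * tent h x - 1) * (w x * w x)).
  apply: bounded_measurableM => //; apply: bounded_measurableB; last first.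
    exact: bounded_measurable_cst.
  by apply: bounded_measurableZ; exact: bm_tent.
have bdF := @bm_mul_partials [:: j] [:: j] ord0 isT isT.
have [CF CF0 FC] := bounded_measurable_bound bF.
have by_parts : \int[mu]_(x in Omega) (theta x *
    (partials [:: ord0; j] u x * w x + w x * partials [:: ord0; j] u x)) <=
    \int[mu]_(x in Omega) ((8 * m / h * tent h x - 1) * (w x * w x)).
  apply: (@Rintegral_by_parts_le _ _ _ (e ord0) oOmega finOmega
    (fun x => w x * w x) _ _ _ (4 * m * CF) (1 + H * (2 / h)) (8 * m / h * CF)) => //.
  - exact: bm_theta.
  - by rewrite !mulr_ge0.
  - by rewrite addr_ge0// mulr_ge0// divr_ge0// ltW.
  - by move=> y Oy; exact: (@is_derive_mul_partials [:: j] [:: j]).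
  - by move=> y t Oy _; exact: theta_lip.
  - move=> y t Oy nO; rewrite normrM (@le_trans _ _ (4 * m * `|t| * CF))//.
      apply: ler_pM => //; last exact: FC.
      rewrite (le_trans (theta_le Oy))// ler_wpM2l ?mulr_ge0//.
      exact: exit_head Oy nO.
    by rewrite [leLHS]mulrAC.
  - move=> y s s0 Oy _; have ww : 0 <= w y * w y by rewrite -expr2 sqr_ge0.
    rewrite (le_trans (ler_wpM2r ww (theta_shift_le s0 Oy)))// -[leLHS]mulrA.
    rewrite ler_wpM2l ?(ltW s0)//.
    have A (p k q : R) : 0 <= k -> q <= CF -> (p + s * k) * q <= p * q + s * (k * CF).
      move=> k0 qC; rewrite mulrDl lerD2l -(mulrA s).
      by rewrite ler_wpM2l ?(ltW s0)// ler_wpM2l.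
    by apply: A => //; rewrite (le_trans (ler_norm _))// FC.
(* Young's inequality in the form [- 2 th p q <= p^2 / 2 + 2 th^2 q^2]: with [|theta| <= 4 m depth]
   the last term gives [32 m^2]. Absorbing [p^2 / 2] doubles the constants to [16 m / h] and
   [64 m^2]. *)
have pw x : Omega x -> 2^-1 * w x ^+ 2 <= 8 * m / h * (tent h x * w x ^+ 2) +
    32 * m ^+ 2 * (depth phi x ^+ 2 * partials [:: j; ord0] u x ^+ 2) +
    (theta x * (partials [:: ord0; j] u x * w x + w x * partials [:: ord0; j] u x) -
     (8 * m / h * tent h x - 1) * (w x * w x)).
  move=> Ox; rewrite (partials_comm oOmega Cu (s := [::]) ord0 j isT Ox).
  have /andP[d0 _] := depth_leH Ox; have := theta_le Ox.
  rewrite ler_norml => /andP[t1 t2].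
  have A (th d p q T : R) : 0 <= d -> - (4 * m * d) <= th -> th <= 4 * m * d ->
      2^-1 * p ^+ 2 <= T * p ^+ 2 + 32 * m ^+ 2 * (d ^+ 2 * q ^+ 2) +
        (th * (q * p + p * q) - (T - 1) * (p * p)).
    move=> d1 th1 th2.
    have th3 : th ^+ 2 <= (4 * m * d) ^+ 2.
      rewrite -[leLHS]real_normK ?num_real// lerXn2r ?nnegrE ?mulr_ge0//.
      by rewrite ler_norml th1.
    have q0 : 0 <= q ^+ 2 := sqr_ge0 q.
    have : th ^+ 2 * q ^+ 2 <= (4 * m * d) ^+ 2 * q ^+ 2 by rewrite ler_wpM2r.
    have := sqr_ge0 (p + 2 * (th * q)).
    by rewrite !expr2; lra.
  by rewrite [8 * m / h * (_ * _)]mulrA; exact: A.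
have bth : bm Omega (fun x => theta x *
    (partials [:: ord0; j] u x * w x + w x * partials [:: ord0; j] u x)).
  by apply: bounded_measurableM; [exact: bm_theta|].
have bw2 : bm Omega (fun x => w x ^+ 2) by exact: bounded_measurableX.
have b1 := bounded_measurableZ (8 * m / h) bt.
have b2 := bounded_measurableZ (32 * m ^+ 2) bd.
have b12 := bounded_measurableD b1 b2.
have b3 := bounded_measurableB bth bk.
have hI := bounded_le_Rintegral mOmega finOmega
  (bounded_measurableZ 2^-1 bw2) (bounded_measurableD b12 b3) pw.
have eL := bounded_RintegralZ mOmega finOmega 2^-1 bw2.
have eR := etrans (bounded_RintegralD mOmega finOmega b12 b3)
  (congr2 +%R (etrans (bounded_RintegralD mOmega finOmega b1 b2)
    (congr2 +%R (bounded_RintegralZ mOmega finOmega (8 * m / h) bt)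
       (bounded_RintegralZ mOmega finOmega (32 * m ^+ 2) bd)))
   (bounded_RintegralB mOmega finOmega bth bk)).
rewrite eL eR in hI.
set S := (X in X <= _) in by_parts; set T := (X in _ <= X) in by_parts.
set X := (X in X <= _); set Y := (X in _ * X + _); set Z := (X in _ + _ * X).
have {}hI : 2^-1 * X <= 8 * m / h * Y + 32 * m ^+ 2 * Z + (S - T) := hI.
rewrite kE; exact: conclude by_parts hI.
Qed.

Lemma grad_estimate :
  \int[mu]_(x in Omega) (\sum_(j < n.+2) partial j u x ^+ 2) <=
  16 * m * Lambda / lambda / h * \int[mu]_(x in Omega) `|u x * partial ord0 u x| +
  64 * m ^+ 2 * (n.+2%:R * (4 * (1 + L) ^+ 2 * Lambda ^+ 2 / lambda ^+ 2)) *
    \int[mu]_(x in Omega) partial ord0 u x ^+ 2.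
Proof.
have conclude (c d E1 E2 U V G : R) : 0 <= d ->
    G <= 16 * m / h * E1 + 64 * m ^+ 2 * E2 -> lambda * E1 <= Lambda * U ->
    E2 <= d * V -> G <= 16 * m * Lambda / lambda / h * U + 64 * m ^+ 2 * d * V.
  move=> d0 hG h1 h2; apply: (le_trans hG); apply: lerD.
    rewrite (_ : _ * U = 16 * m / h * (Lambda * U / lambda)); last first.
      by field; rewrite !lt0r_neq0.
    apply: ler_wpM2l; last by rewrite ler_pdivlMr// mulrC.
    by rewrite divr_ge0 ?mulr_ge0 ?(le_trans ler01 m1)// ltW.
  by rewrite -[leRHS]mulrA ler_wpM2l// mulr_ge0// sqr_ge0.
have b1 j : bm Omega (fun x => partial j u x ^+ 2).
  by apply: bounded_measurableX; exact: (@bmP [:: j]).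
have bt j : bm Omega (fun x => tent h x * partial j u x ^+ 2).
  by apply: bounded_measurableM; [exact: bm_tent|exact: b1].
have bd j : bm Omega (fun x => depth phi x ^+ 2 * partials [:: j; ord0] u x ^+ 2).
  by apply: bounded_measurableM; apply: bounded_measurableX; [exact: bm_depth|exact: bmP].
apply: conclude tent_energy depth_energy => //.
  rewrite mulr_ge0// divr_ge0// ?sqr_ge0//.
  by rewrite mulr_ge0 ?sqr_ge0// mulr_ge0 ?sqr_ge0.
under [X in _ * X + _]eq_Rintegral do rewrite mulr_sumr.
under [X in _ + _ * X]eq_Rintegral do rewrite mulr_sumr.
rewrite !bounded_Rintegral_sum// !mulr_sumr -big_split.
by apply: ler_sum => j _; exact: fibre_hardy.
Qed.

End estimates.

(** * Passage from integrals to L^2 norms *)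

Section L2norm.
Context {R : realType} (n : nat) (O : set 'rV[R]_n).
Local Notation mu := (@lebesgue_rV R n).
Hypotheses (mO : measurable O) (finO : (mu O < +oo)%E).

(** Only the square is asked to be bounded and measurable: for [enorm (grad u)] it is a polynomial
    in the partial derivatives. *)
Lemma L2norm_eq (f g : 'rV[R]_n -> R) : bounded_measurable O g ->
  (forall x, O x -> f x ^+ 2 = g x) ->
  L2norm O f = (Num.sqrt (\int[mu]_(x in O) g x))%:E.
Proof.
move=> bg fg; rewrite /L2norm Lnorm.unlock.
have -> : (\int[mu]_x `|((EFin \o f) \_ O) x| `^ 2 = \int[mu]_(x in O) (g x)%:E)%E.
  rewrite [RHS]integral_mkcond; apply: eq_integral => x _.
  rewrite !patchE; case: ifPn => [/set_mem Ox|_].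
    rewrite (_ : (`|(EFin \o f) x| = `|f x|%:E)%E)// poweR_EFin powR_mulrn//.
    by rewrite -fg// real_normK// num_real.
  by rewrite abse0 poweR0r.
have int_g := bounded_measurable_integrable mO finO bg.
rewrite -(fineK (integrable_fin_num mO int_g)) -/(Rintegral mu O g).
rewrite poweR_EFin powR12_sqrt// Rintegral_ge0// => x Ox.
by rewrite -fg// sqr_ge0.
Qed.

Lemma cauchy_schwarz (f g : 'rV[R]_n -> R) :
  bounded_measurable O f -> bounded_measurable O g ->
  \int[mu]_(x in O) `|f x * g x| <=
  Num.sqrt (\int[mu]_(x in O) f x ^+ 2) * Num.sqrt (\int[mu]_(x in O) g x ^+ 2).
Proof.
have discr (p q r : R) : 0 <= p -> 0 <= q -> 0 <= r ->
    (forall t, 2 * t * r <= t ^+ 2 * p + q) -> r <= Num.sqrt p * Num.sqrt q.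
  move=> p0 q0 r0 h; rewrite -sqrtrM// -[leLHS]ger0_norm// -sqrtr_sqr.
  rewrite ler_sqrt ?mulr_ge0//.
  have [pp|pp] := ltP 0 p.
    have := h (r / p).
    rewrite (_ : _ ^+ 2 * p = r ^+ 2 / p); last by field; exact: lt0r_neq0.
    rewrite (_ : 2 * _ * r = 2 * (r ^+ 2 / p)); last by field; exact: lt0r_neq0.
    by move=> h1; rewrite -ler_pdivrMl// mulrC; lra.
  have p00 : p = 0 by apply/eqP; rewrite eq_le pp.
  have [rr|rr] := ltP 0 r; last first.
    by rewrite (_ : r = 0) ?expr0n ?mulr_ge0//; apply/eqP; rewrite eq_le rr.
  (* With [p = 0] and [r > 0], this choice of [t] turns the hypothesis into [q + 1 <= q]. *)
  have := h ((q + 1) / (2 * r)); rewrite p00 mulr0 add0r.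
  rewrite (_ : 2 * _ * r = q + 1); last by field; exact: lt0r_neq0.
  lra.
move=> bf bg.
have bf2 := bounded_measurableX 2 bf; have bg2 := bounded_measurableX 2 bg.
have bfg := bounded_measurable_norm (bounded_measurableM bf bg).
apply: discr; try by apply: Rintegral_ge0 => x _; rewrite ?sqr_ge0.
move=> t; rewrite -(bounded_RintegralZ mO finO (2 * t) bfg).
have bt := bounded_measurableZ (t ^+ 2) bf2.
rewrite -(bounded_RintegralZ mO finO (t ^+ 2) bf2).
rewrite -(bounded_RintegralD mO finO bt bg2).
apply: bounded_le_Rintegral => //; first exact: bounded_measurableZ.
  exact: bounded_measurableD.
move=> x _; rewrite -[f x ^+ 2]real_normK ?num_real//.
rewrite -[g x ^+ 2]real_normK ?num_real// normrM.
have A (p q : R) : 2 * t * (p * q) <= t ^+ 2 * p ^+ 2 + q ^+ 2.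
  by have := sqr_ge0 (t * p - q); lra.
exact: A.
Qed.

End L2norm.

(** * Consequences of the Lipschitz constant, and the conclusion *)

Section Lip.
Context {R : realType} (n : nat) (omega : set 'rV[R]_n) (phi : 'rV[R]_n -> R) (L : R).
Hypothesis phiL : Lip omega phi = L%:E.

Lemma enorm_gt0 (x : 'rV[R]_n) : x != 0 -> 0 < enorm x.
Proof.
move=> x0; rewrite lt_neqAle enorm_ge0 andbT eq_sym; apply: contra x0 => /eqP ex.
apply/eqP/rowP => i; rewrite mxE; apply/eqP; rewrite -sqrf_eq0.
have := sqr_enorm x; rewrite ex expr0n/= => /esym/eqP.
rewrite psumr_eq0 => [/allP/(_ i)|j _]; last exact: sqr_ge0.
by apply; rewrite mem_index_enum.
Qed.

Lemma Lip_le x y : omega x -> omega y -> `|phi x - phi y| <= L * enorm (x - y).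
Proof.
move=> ox oy; have [->|xy] := eqVneq x y.
  rewrite !subrr normr0 (_ : enorm 0 = 0) ?mulr0//.
  by rewrite /enorm big1 ?sqrtr0// => i _; rewrite mxE expr0n.
rewrite -ler_pdivrMr ?enorm_gt0 ?subr_eq0// -lee_fin -phiL.
by apply: ereal_sup_ubound; exists x, y.
Qed.

(** [sup] is a genuine supremum only for a set that is bounded above; here this follows from the
    Lipschitz bound and the boundedness of [omega]. *)
Lemma has_ubound_Lip : 0 <= L -> bounded_set omega -> has_ubound (phi @` omega).
Proof.
move=> L0 [M [_ /(_ (M + 1))]]; rewrite ltrDl ltr01 => /(_ isT) oM.
have [e|/set0P[x0 ox0]] := eqVneq omega set0.
  by exists 0 => z [x]; rewrite e.

exists (phi x0 + L * (n%:R * (M + 1 + (M + 1)))) => _ [x ox <-].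
rewrite addrC -lerBlDr (le_trans (ler_norm _))// (le_trans (Lip_le ox ox0))//.
rewrite ler_wpM2l// (le_trans (enorm_le _))// ler_wpM2l//.
by rewrite (le_trans (ler_normB _ _))// lerD//; exact: oM.
Qed.

End Lip.

(* The ambient dimension is n.+2, so that every dimension at least 2 occurs;
   omega lies in dimension n.+1. *)
Theorem theorem1p1 (R : realType) (n : nat) (lambda Lambda L m : R) :
  0 < lambda -> 0 < Lambda -> 0 <= L -> 1 <= m ->
  exists C : R,
  forall (omega : set 'rV[R]_n.+1) (phi : 'rV[R]_n.+1 -> R),
  let H := sup (phi @` omega) in
  let h := inf (phi @` omega) in
  let Omega := subgraph omega phi in
  let Gamma := lateral_bdry omega Omega in
  bounded_set omega -> lipschitz_domain omega ->
  (forall x', omega x' -> 0 < phi x') ->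
  Lip omega phi = L%:E ->
  0 < h -> H / h = m ->
  forall a : 'M[R]_n.+2,
  (forall xi : 'rV[R]_n.+2, lambda * enorm xi ^+ 2 <=
     \sum_(i < n.+2) \sum_(j < n.+2) a i j * xi ord0 i * xi ord0 j) ->
  (forall j : 'I_n.+2, \sum_(i < n.+2) `|a i j| <= Lambda) ->
  forall u : 'rV[R]_n.+2 -> R,
  Ck_closure 3 Omega u ->
  (forall x, Omega x -> const_op a u x = 0) ->
  (forall x, Gamma x -> u x = 0) ->
  (L2norm Omega (fun x => enorm (grad u x)) ^+ 2 <=
     (C / h)%:E * L2norm Omega u * L2norm Omega (partial ord0 u)
     + C%:E * L2norm Omega (partial ord0 u) ^+ 2)%E.

Proof.
move=> lambda0 Lambda0 L0 m1.
pose d := n.+2%:R * (4 * (1 + L) ^+ 2 * Lambda ^+ 2 / lambda ^+ 2).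
pose C1 := 16 * m * Lambda / lambda; pose C2 := 64 * m ^+ 2 * d.
have m0 : 0 <= m := le_trans ler01 m1.
have C10 : 0 <= C1 by rewrite divr_ge0 ?(ltW lambda0)// mulr_ge0 ?(ltW Lambda0)// mulr_ge0.
have d0 : 0 <= d.
  apply: mulr_ge0 => //; apply: divr_ge0; last exact: sqr_ge0.
  by apply: mulr_ge0; [apply: mulr_ge0 => //|]; exact: sqr_ge0.
have C20 : 0 <= C2 by apply: mulr_ge0 => //; apply: mulr_ge0 => //; exact: sqr_ge0.
(* One constant serves both terms: [C1] comes from the tent estimate for [u], [C2] from the energy
   of [v], and both are nonnegative. *)
exists (C1 + C2).
move=> omega phi H h Omega Gamma bomega [omega0 oomega _ _] phi0 phiL h0 Hhm a
  elliptic aLambda u Cu Lu0 u0.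
have ubphi : has_ubound (phi @` omega) by exact: has_ubound_Lip phiL L0 bomega.
have lbphi : has_lbound (phi @` omega) by exists 0 => _ [x ox <-]; exact/ltW/phi0.
have phi_bound x : omega x -> h <= phi x <= H.
  move=> ox; rewrite ge_inf ?ub_le_sup//; by exists x.
have Hm : H = m * h by rewrite -Hhm divfK// lt0r_neq0.
have hH : h <= H by rewrite Hm ler_peMl// ltW.
have phi_lip := Lip_le phiL.
have oOmega : open Omega := open_subgraph oomega L0 phi_lip.
have bOmega : bounded_set Omega := bounded_subgraph bomega phi_bound.
have mOmega := measurable_open_rV oOmega.
have finOmega := lebesgue_rV_bounded mOmega bOmega.
have bu s : (size s <= 3)%N -> bounded_measurable Omega (partials s u).
  exact: partials_bounded_measurable.
have bgrad : bounded_measurable Omega (fun x => \sum_(j < n.+2) partial j u x ^+ 2).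
  apply: bounded_measurable_sum => j; apply: bounded_measurableX.
  exact: (bu [:: j]).
have est : \int[lebesgue_rV n.+2]_(x in Omega) (\sum_(j < n.+2) partial j u x ^+ 2) <=
    C1 / h * \int[lebesgue_rV n.+2]_(x in Omega) `|u x * partial ord0 u x| +
    C2 * \int[lebesgue_rV n.+2]_(x in Omega) partial ord0 u x ^+ 2.
  have Hm' : H <= m * h by rewrite Hm.
  exact: (grad_estimate oomega bomega L0 h0 hH phi_bound phi_lip Cu u0 lambda0
    elliptic aLambda Lu0 m1 Hm').
have cs := cauchy_schwarz mOmega finOmega (bu [::] isT) (bu [:: ord0] isT).
rewrite (L2norm_eq mOmega finOmega bgrad); last first.
  by move=> x _; rewrite sqr_enorm; apply: eq_bigr => j _; rewrite mxE.
rewrite (L2norm_eq mOmega finOmega (bounded_measurableX 2 (bu [::] isT)))//.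
rewrite (L2norm_eq mOmega finOmega (bounded_measurableX 2 (bu [:: ord0] isT)))//.
rewrite -!EFin_expe -!EFinM -EFinD lee_fin.
rewrite !sqr_sqrtr; last first.
- by apply: Rintegral_ge0 => x _; apply: sumr_ge0 => j _; exact: sqr_ge0.
- by apply: Rintegral_ge0 => x _; exact: sqr_ge0.
apply: (le_trans est); apply: lerD; last first.
  apply: ler_wpM2r; last by rewrite lerDr.
  by apply: Rintegral_ge0 => x _; exact: sqr_ge0.
rewrite -[leRHS]mulrA; apply: (ler_pM _ _ _ cs).
- by rewrite divr_ge0// ltW.
- by apply: Rintegral_ge0 => x _; exact: normr_ge0.
- by rewrite ler_wpM2r ?invr_ge0 ?(ltW h0)// lerDl.
Qed.
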